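(* Let $\bm{Y}^{(n)}=(Y_1,\dots,Y_n)$ follow the multivariate phase-type distribution with parameters $\bm{\alpha}, A_1,\dots,A_n, D_1,\dots,D_n$ (as defined in the context). Then $\bm{Y}^{(n)}$ has density function $$f(y_1,y_2,\dots,y_n)=\bm{\alpha}\,e^{A_1y_1}D_1\,e^{A_2y_2}D_2\cdots e^{A_ny_n}D_n\bm{1},\qquad y_i\ge 0,\ i=1,\dots,n.$$
   Context: $\bm{1}$ and $\bm{0}$ denote vectors of ones and zeros of appropriate size and orientation. Multivariate phase-type distribution: let $n\in\{1,2,\dots\}$ and let $\{\varphi(t)\mid t\ge 0\}$ be a time-homogeneous Markov jump process on the finite state space $\{\star\}\cup\mathcal{S}_1\cup\cdots\cup\mathcal{S}_n$ (disjoint union), where $\star$ is absorbing and every $\mathcal{S}_k$ is a finite nonempty set of transient states. Its generator has the following form. For $k=1,\dots,n$, the transition rates within $\mathcal{S}_k$ are given by a square matrix $A_k$ indexed by $\mathcal{S}_k$ (off-diagonal entries nonnegative). For $k<n$, the transition rates from $\mathcal{S}_k$ to $\mathcal{S}_{k+1}$ are given by a nonnegative $|\mathcal{S}_k|\times|\mathcal{S}_{k+1}|$ matrix $D_k$. The transition rates from $\mathcal{S}_n$ to $\star$ are given by the vector $D_n\bm{1}$, with $D_n$ a nonnegative matrix with rows indexed by $\mathcal{S}_n$. All other transition rates between distinct states are $0$; hence $A_k\bm{1}+D_k\bm{1}=\bm{0}$ for all $k$, and each $A_k$ is invertible by transience. The process starts in $\mathcal{S}_1$ with initial distribution given by the probability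 (row) vector $\bm{\alpha}$ on $\mathcal{S}_1$. The vector $(Y_1,\dots,Y_n)$ follows the multivariate phase-type distribution with these parameters if it is (distributed as) the vector of times spent in the subsets $\mathcal{S}_k$: $Y_k=\int_0^\infty \mathbf{1}_{\{\varphi(s)\in\mathcal{S}_k\}}\,ds$, $k=1,\dots,n$. *)

(* Defs.v *)
From HB Require Import structures.
From mathcomp Require Import all_boot all_order all_algebra.
From mathcomp Require Import all_classical all_reals all_analysis.

Set Implicit Arguments.
Unset Strict Implicit.
Unset Printing Implicit Defensive.

Import Order.TTheory GRing.Theory Num.Theory numFieldNormedType.Exports.

Local Open Scope classical_set_scope.
Local Open Scope ring_scope.

Section matrix_exponential.
Context {R : realType} {m : nat}.

(* The matrix analogue of [expR]; the limit is taken in the normed topology of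
   ['M[R]_m]. *)
Definition expmx (A : 'M[R]_m) : 'M[R]_m :=
  limn (series (fun k : nat => k`!%:R^-1 *: A ^+ k)).

End matrix_exponential.

Section lebesgue_measure_on_tuples.
Context {R : realType}.

Definition tuple_of_pair n (x : measurableTypeR R * n.-tuple R) : n.+1.-tuple R :=
  [tuple of x.1 :: x.2].

Lemma measurable_tuple_of_pair n :
  measurable_fun [set: measurableTypeR R * n.-tuple R] (@tuple_of_pair n).
Proof. exact: (measurable_cons measurable_fst measurable_snd). Qed.

Section step.
Variables (n : nat) (mu : {sigma_finite_measure set (n.-tuple R) -> \bar R}).

Definition lebesgue_times : set (n.+1.-tuple R) -> \bar R :=
  pushforward (@lebesgue_measure R \x mu)%E (@tuple_of_pair n).

HB.instance Definition _ := Measure.copy lebesgue_times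
  (measure_function_pushforward__canonical__measure_function_Measure
    (@lebesgue_measure R \x mu)%E (@measurable_tuple_of_pair n)).

Let lebesgue_times_sigma_finite : sigma_finite setT lebesgue_times.
Proof.
have /sigma_finiteP[F [TF ndF Foo]] := sigma_finiteT (@lebesgue_measure R).
have /sigma_finiteP[G [TG ndG Goo]] := sigma_finiteT mu.
pose g (y : n.+1.-tuple R) : measurableTypeR R * n.-tuple R :=
  (thead y, [tuple of behead y]).
have gK : cancel (@tuple_of_pair n) g.
  by move=> [x y]; rewrite /g /tuple_of_pair theadE; congr pair; exact: val_inj.
have mg : measurable_fun setT g.
  by apply: measurable_fun_pair; [exact: measurable_tnth|exact: measurable_behead].
exists (fun i => g @^-1` (F i `*` G i)) => [|i].
  apply/esym/seteqP; split=> // y _.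
  have [i _ Fy] : (\bigcup_i F i) (g y).1 by rewrite -TF.
  have [j _ Gy] : (\bigcup_j G j) (g y).2 by rewrite -TG.
  exists (maxn i j) => //; split.
  - by move: Fy; exact/subsetPset/ndF/leq_maxl.
  - by move: Gy; exact/subsetPset/ndG/leq_maxr.
have [mF oF] := Foo i; have [mG oG] := Goo i; split.
  by rewrite -[X in measurable X]setTI; apply: mg => //; exact: measurableX.
rewrite /lebesgue_times /pushforward [X in (_ X < _)%E](_ : _ = F i `*` G i).
  by rewrite product_measure1E// lte_mul_pinfty// ge0_fin_numE.
by apply/funext => x; rewrite -[RHS](congr1 _ (gK x)).
Qed.

HB.instance Definition _ := Measure_isSigmaFinite.Build _ _ _ lebesgue_times
  lebesgue_times_sigma_finite.

End step.

(* Lebesgue measure on R^n (Borel sets), as the n-fold product measure. *)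
Fixpoint lebesgue_tuple n : {sigma_finite_measure set (n.-tuple R) -> \bar R} :=
  if n is n'.+1 then lebesgue_times (lebesgue_tuple n') else \d_[tuple].

End lebesgue_measure_on_tuples.

Section density.
Context {d : measure_display} {T : measurableType d} {R : realType}.
Context (P : probability T R) {n : nat}.

Definition has_density (Y : {RV P >-> n.-tuple R}) (f : n.-tuple R -> R) : Prop :=
  [/\ measurable_fun [set: n.-tuple R] f,
      forall y, 0 <= f y &
      forall B : set (n.-tuple R), measurable B ->
        distribution P Y B = (\int[lebesgue_tuple n]_(y in B) (f y)%:E)%E].

End density.

Section markov_jump_processes.
Context {R : realType} {S : finType}.

(* Functions of time are total on [R]; only times [0 <= t] are relevant. *)

Record transition_function (p : R -> S -> S -> R) : Prop := TransitionFunction {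
  transition_ge0 : forall t i j, 0 <= t -> 0 <= p t i j ;
  transition_sum : forall t i, 0 <= t -> \sum_j p t i j = 1 ;
  transition_0 : forall i j, p 0 i j = (i == j)%:R ;
  transition_semigroup : forall s t i j, 0 <= s -> 0 <= t ->
    p (s + t) i j = \sum_k p s i k * p t k j }.

Definition has_generator (p : R -> S -> S -> R) (Q : S -> S -> R) : Prop :=
  forall i j, (p h i j - (i == j)%:R) / h @[h --> 0^'+] --> Q i j.

(* The expected total time spent in [i], starting from [i], is finite. *)
Definition transient (p : R -> S -> S -> R) (i : S) : Prop :=
  (\int[lebesgue_measure]_(t in `[0%R, +oo[) (p t i i)%:E < +oo)%E.

Section process.
Context {d : measure_display} {T : measurableType d} (P : probability T R).
Variable phi : R -> T -> S.

(* Since [S] is finite, right-continuity with left limits (in the discrete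
   topology) means that each path is a right-continuous step function with
   finitely many jumps in every bounded interval. *)
Definition jump_paths : Prop := forall w t, 0 <= t ->
  (\forall s \near t^'+, phi s w = phi t w) /\
  (0 < t -> exists i, \forall s \near t^'-, phi s w = i).

(* [hist] lists time-state pairs of an arbitrary finite part of the past up to
   time [s]. The Markov property
   P(phi t = j | phi s = i, hist) = p (t - s) i j
   is written without conditional probabilities, so that conditioning events
   of probability zero need no separate treatment. *)
Record markov_jump_process (pi : S -> R) (p : R -> S -> S -> R) : Prop :=
  MarkovJumpProcess {
  mjp_measurable : forall t i, 0 <= t -> measurable [set w | phi t w = i] ;
  mjp_paths : jump_paths ;
  mjp_transition : transition_function p ;
  mjp_initial : forall i, P [set w | phi 0 w = i] = (pi i)%:E ;
  mjp_markov : forall (hist : seq (R * S)) s t i j,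
    (forall x, x \in hist -> 0 <= x.1 <= s) -> 0 <= s <= t ->
    P [set w | [/\ forall x, x \in hist -> phi x.1 w = x.2,
                   phi s w = i & phi t w = j]] =
    (P [set w | (forall x, x \in hist -> phi x.1 w = x.2) /\ phi s w = i] *
     (p (t - s) i j)%:E)%E }.

End process.
End markov_jump_processes.

(* Blocks are numbered from 0: for [k < n], [dim k], [A k] and [D k] stand for
   |S_(k+1)|, A_(k+1) and D_(k+1), and S_(k+1) is identified with ['I_(dim k)].
   The last matrix [D n.-1] has [dim n] columns, where [dim n] is arbitrary.
   Indices beyond these play no role. *)
Section multivariate_phase_type.
Context {R : realType}.
Variables (n : nat) (dim : nat -> nat).
Variable alpha : 'rV[R]_(dim 0%N).
Variable A : forall k, 'M[R]_(dim k).
Variable D : forall k, 'M[R]_(dim k, dim k.+1).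

Record mph_parameters : Prop := MphParameters {
  mph_n_gt0 : (0 < n)%N ;
  mph_dim_gt0 : forall k, (k < n)%N -> (0 < dim k)%N ;
  mph_alpha_ge0 : forall i, 0 <= alpha ord0 i ;
  mph_alpha_sum : \sum_i alpha ord0 i = 1 ;
  mph_A_ge0 : forall k, (k < n)%N -> forall i j, i != j -> 0 <= A k i j ;
  mph_D_ge0 : forall k, (k < n)%N -> forall i j, 0 <= D k i j ;
  mph_AD0 : forall k, (k < n)%N ->
    A k *m const_mx 1 + D k *m const_mx 1 = 0 :> 'cV[R]_(dim k) }.

(* [None] is the absorbing state. *)
Definition mph_state := option {k : 'I_n & 'I_(dim k)}.

Definition mph_block (k : 'I_n) (s : mph_state) : bool :=
  if s is Some u then tag u == k else false.

Definition mph_initial (s : mph_state) : R :=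
  if s is Some (existT k i) then
    if val k =P 0%N is ReflectT e then alpha ord0 (cast_ord (congr1 dim e) i)
    else 0
  else 0.

Definition mph_generator (s s' : mph_state) : R :=
  match s, s' with
  | Some (existT k i), Some (existT l j) =>
      if val l =P val k is ReflectT e then A k i (cast_ord (congr1 dim e) j)
      else if val l =P k.+1 is ReflectT e then
        D k i (cast_ord (congr1 dim e) j)
      else 0
  | Some (existT k i), None =>
      if k.+1 == n then (D k *m const_mx 1 : 'cV[R]_(dim k)) i ord0 else 0
  | None, _ => 0
  end.

Definition occupation_times (T : Type) (phi : R -> T -> mph_state) (w : T) :
    n.-tuple R :=
  [tuple \int[lebesgue_measure]_(s in `[0, +oo[) (mph_block k (phi s w))%:R
    | k < n].

(* [Rintegral] is real-valued: it is the (extended) occupation time whenever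
   that is finite, which transience ensures almost surely. *)
Definition multivariate_phase_type (d : measure_display) (T : measurableType d)
    (P : probability T R) (Y : {RV P >-> n.-tuple R}) : Prop :=
  exists (d' : measure_display) (T' : measurableType d')
    (P' : probability T' R) (phi : R -> T' -> mph_state)
    (p : R -> mph_state -> mph_state -> R),
  [/\ markov_jump_process P' phi mph_initial p,
      has_generator p mph_generator,
      forall u, transient p (Some u) &
      forall B : set (n.-tuple R), measurable B ->
        distribution P Y B = P' (occupation_times phi @^-1` B)].

(* The row vector alpha e^(A_1 y_1) D_1 ... e^(A_k y_k) D_k. *)
Fixpoint mph_row (y : nat -> R) (k : nat) : 'rV[R]_(dim k) :=
  if k is k'.+1 then mph_row y k' *m expmx (y k' *: A k') *m D k' else alpha.

(* Densities live on R^n; this one vanishes off the nonnegative orthant. *)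
Definition mph_density (y : n.-tuple R) : R :=
  if [forall i, 0 <= tnth y i]
  then (mph_row (nth 0 y) n *m const_mx 1 : 'M[R]_1) ord0 ord0
  else 0.

End multivariate_phase_type.

(* Main.v *)
From HB Require Import structures.
Require Import Defs.
From mathcomp Require Import all_boot all_order all_algebra.
From mathcomp Require Import all_classical all_reals all_analysis.
From mathcomp Require Import measurable_realfun.
From mathcomp Require Import zify ring lra.

(** The blocks are visited in increasing order, so that the partial sums
    [T_k = Y_1 + ... + Y_k] of the occupation times are the times at which the
    blocks are left. A law on the orthant is determined by the probabilities of the
    boxes [a_k < T_k <= b_k] whose intervals are ordered, [b_k <= a_(k+1)]
    ([box_measure_unique]). For a nondecreasing path such an event only says that
    the process is in block [k] at time [a_k] and in block [k+1] at time [b_k]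
    ([in_box_levels]), and paths are almost surely nondecreasing, so that the Markov
    property gives its probability as a product of transition probabilities
    ([level_times_in_box]). These boxes leave out the sequences with a
    vanishing coordinate, among them the paths that would skip a block.

    On the side of the density, the generator yields the forward and backward
    equations and the exponential series of the transition function, whose diagonal
    blocks are therefore the exponentials [e^(A_k t)] ([expmx_block]). The
    convolution of [e^(A_k x) D_k] with [e^(A_(k+1) (t - x))] over [a < x <= b] is
    the integral of a derivative, and evaluates to a product of transition
    probabilities ([integral_passage]). Integrating the coordinates successively
    with Tonelli's theorem, the integral of the density over a box is the same
    product as above ([integral_box]).

    It remains to see that no mass is lost outside the open orthant, which amounts to
    the density having total mass [1] ([integral_orthant]). This is where
    transience enters: the probability of being in a transient state tends to [0]
    ([transient_cvg]), so that each block is left with probability one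
    ([integral_passage_total]). *)

Set Implicit Arguments.
Unset Strict Implicit.
Unset Printing Implicit Defensive.

Import Order.TTheory GRing.Theory Num.Theory numFieldNormedType.Exports.

Local Open Scope classical_set_scope.
Local Open Scope ring_scope.

(** * Transition functions of finite-state chains *)

Lemma cvg_bigsum (R : realType) (T I : Type) (F : set_system T) {FF : Filter F}
    (r : seq I) (P : pred I) (f : I -> T -> R) (l : I -> R) :
  (forall i, P i -> f i x @[x --> F] --> l i) ->
  \sum_(i <- r | P i) f i x @[x --> F] --> \sum_(i <- r | P i) l i.
Proof. by move=> fl; apply: (cvg_big (op := +%R)) => //; exact: add_continuous. Qed.

Lemma is_derive_bigsum (R : realType) (I : Type) (r : seq I) (P : pred I)
    (f : I -> R -> R) (df : I -> R) (t : R) :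
  (forall i, P i -> is_derive t 1 (f i) (df i)) ->
  is_derive t 1 (fun x => \sum_(i <- r | P i) f i x) (\sum_(i <- r | P i) df i).
Proof.
move=> fdf; elim: r => [|i r ih].
  rewrite big_nil (_ : (fun _ => _) = cst 0); first exact: is_derive_cst.
  by apply/funext => x; rewrite big_nil.
rewrite big_cons; case: ifPn => Pi; last first.
  rewrite (_ : (fun _ => _) = (fun x => \sum_(j <- r | P j) f j x)) //.
  by apply/funext => x; rewrite big_cons (negbTE Pi).
rewrite (_ : (fun _ => _) = f i \+ (fun x => \sum_(j <- r | P j) f j x)).
  by apply: is_deriveD; exact: fdf.
by apply/funext => x; rewrite big_cons Pi.
Qed.

Lemma is_derive_quotient (R : realType) (f : R -> R) (t l : R) :
  (f (t + h) - f t) / h @[h --> 0^'] --> l -> is_derive t 1 f l.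
Proof.
move=> fl.
have fl' : h^-1 *: (f (h *: 1 + t) - f t) @[h --> 0^'] --> l.
  apply: cvg_trans fl; apply: near_eq_cvg; near=> h.
  by rewrite /= [h *: 1]mulr1 [t + h]addrC [LHS]mulrC.
apply: DeriveDef; first by apply/cvg_ex; exists l.
by apply/cvg_lim => //; exact: Rhausdorff.
Unshelve. all: by end_near. Qed.

Section transition.
Context {R : realType} {S : finType}.
Variables (p : R -> S -> S -> R) (Q : S -> S -> R).
Hypotheses (ptr : transition_function p) (pQ : has_generator p Q).

(** Freezing the transition function at its value at [0] on negative times
    makes it continuous on the whole line. *)
Definition ptrans (t : R) (i j : S) : R := p (Num.max 0 t) i j.

Lemma ptransE t i j : 0 <= t -> ptrans t i j = p t i j.
Proof. by move=> t0; rewrite /ptrans max_r. Qed.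

Lemma ptrans_ge0 t i j : 0 <= ptrans t i j.
Proof. by apply: (transition_ge0 ptr); rewrite le_max lexx. Qed.

Lemma ptrans_sum t i : \sum_j ptrans t i j = 1.
Proof. by apply: (transition_sum ptr); rewrite le_max lexx. Qed.

Lemma ptrans_le1 t i j : ptrans t i j <= 1.
Proof.
rewrite -(ptrans_sum t i) (bigD1 j) //= lerDl.
by apply: sumr_ge0 => k _; exact: ptrans_ge0.
Qed.

Lemma ptrans0 i j : ptrans 0 i j = (i == j)%:R.
Proof. by rewrite ptransE// (transition_0 ptr). Qed.

Lemma ptransD s t i j : 0 <= s -> 0 <= t ->
  ptrans (s + t) i j = \sum_k ptrans s i k * ptrans t k j.
Proof.
move=> s0 t0; rewrite ptransE ?addr_ge0// (transition_semigroup ptr)//.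
by apply: eq_bigr => k _; rewrite !ptransE.
Qed.

Lemma generator_norm i j :
  (ptrans `|h : R| i j - (i == j)%:R) / `|h| @[h --> 0^'] --> Q i j.
Proof.
have nh : `|h : R| @[h --> (0:R)^'] --> (0:R)^'+.
  move=> A [e /= e0 eA]; exists e => //= h /=; rewrite sub0r normrN => he h0.
  by apply: eA; rewrite /= ?sub0r ?normrN ?normr_id// normr_gt0.
have := cvg_comp _ _ nh (@pQ i j); apply: cvg_trans; apply: near_eq_cvg; near=> h.
by rewrite /= ptransE.
Unshelve. all: by end_near. Qed.

Lemma ptrans_norm_cvg i j : ptrans `|h : R| i j @[h --> 0] --> ((i == j)%:R : R).
Proof.
suff : ptrans `|h : R| i j @[h --> 0^'] --> ((i == j)%:R : R).
  move=> H A /[dup] A1 /H /= [e /= e0 eA]; exists e => //= h he.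
  have [->|h0] := eqVneq h 0; last exact: eA.
  by rewrite /= normr0 ptrans0; exact: nbhs_singleton.
have : `|h : R| * ((ptrans `|h| i j - (i == j)%:R) / `|h|) + (i == j)%:R
    @[h --> 0^'] --> 0 * Q i j + (i == j)%:R.
  apply: cvgD; last exact: cvg_cst.
  apply: cvgM; last exact: generator_norm.
  have /cvg_norm : h @[h --> (0 : R)^'] --> (0 : R) by exact: nbhs_dnbhs.
  by rewrite normr0.
rewrite mul0r add0r; apply: cvg_trans; apply: near_eq_cvg; near=> h.
rewrite mulrC divfK ?subrK// normr_eq0; near: h; exact: nbhs_dnbhs_neq.
Unshelve. all: by end_near. Qed.

(** Chapman-Kolmogorov over the increment: a modulus of continuity that does not
    depend on the position, and hence gives continuity from both sides. *)
Lemma ptrans_lipschitz s t i j : 0 <= s <= t ->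
  `|ptrans t i j - ptrans s i j| <=
  \sum_k `|ptrans `|t - s| i k - (i == k)%:R|.
Proof.
move=> /andP[s0 st]; have ts0 : 0 <= t - s by rewrite subr_ge0.
rewrite -{1}(subrK s t) ptransD// (ger0_norm ts0).
have -> : ptrans s i j = \sum_k (i == k)%:R * ptrans s k j.
  rewrite (bigD1 i)//= eqxx mul1r big1 ?addr0// => k.
  by rewrite eq_sym => /negbTE ->; rewrite mul0r.
rewrite -sumrB; apply: le_trans (ler_norm_sum _ _ _) _; apply: ler_sum => k _.
rewrite -mulrBl normrM ler_piMr//.
by rewrite ger0_norm ?ptrans_ge0 ?ptrans_le1.
Qed.

Lemma ptrans_continuous i j : continuous (fun t => ptrans t i j).
Proof.
move=> t; apply/cvgrPdist_le => e e0.
have : \sum_k `|ptrans `|h : R| i k - (i == k)%:R| @[h --> 0] --> (0 : R).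
  rewrite -[X in _ --> X](@big1_eq _ 0 +%R S (index_enum S) xpredT).
  apply: cvg_bigsum => k _.
  have : ptrans `|h : R| i k - (i == k)%:R @[h --> 0] --> ((i == k)%:R - (i == k)%:R : R).
    by apply: cvgB; [exact: ptrans_norm_cvg|exact: cvg_cst].
  by move=> /cvg_norm; rewrite subrr normr0.
have m0 : Num.max 0 t - Num.max 0 s @[s --> t] --> (0 : R).
  rewrite -[X in _ --> X](subrr (Num.max 0 t)).
  apply: cvgB; first exact: cvg_cst.
  by apply: (@continuous_max _ _ (cst 0) id); [exact: cvg_cst|exact: cvg_id].
move=> /(cvg_comp _ _ m0) /cvgrPdist_le /(_ _ e0); apply: filterS => s.
rewrite /= sub0r normrN; apply: le_trans.
have pm r : ptrans r i j = ptrans (Num.max 0 r) i j.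
  by rewrite [RHS]ptransE ?le_max ?lexx.
rewrite pm (pm s) [leRHS]ger0_norm; last by apply: sumr_ge0.
have [st|/ltW st] := leP (Num.max 0 s) (Num.max 0 t).
  by apply: ptrans_lipschitz; rewrite st le_max lexx.
by rewrite distrC (distrC (Num.max 0 t)); apply: ptrans_lipschitz;
  rewrite st le_max lexx.
Qed.

Lemma ptrans_min_cvg (t : R) i j :
  ptrans (Num.min t (t + h)) i j @[h --> 0^'] --> ptrans t i j.
Proof.
have th : t + h @[h --> 0^'] --> t + 0.
  by apply: cvgD; [exact: cvg_cst|exact: nbhs_dnbhs].
rewrite addr0 in th.
have mt : Num.min t s @[s --> t] --> Num.min t t.
  by apply: (@continuous_min _ _ (cst t) id); [exact: cvg_cst|exact: cvg_id].
rewrite minxx in mt; have m0 := cvg_comp _ _ th mt.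
exact: (cvg_comp _ _ m0 (@ptrans_continuous i j t)).
Qed.

(** The generator only gives the right derivative at [0]. An increment of either
    sign is factored through the smaller of the two times [t] and [t + h], where
    continuity applies, so that the derivative is two-sided. *)
Lemma ptrans_backward (t : R) i j : 0 < t ->
  is_derive t 1 (fun t : R => ptrans t i j) (\sum_k Q i k * ptrans t k j).
Proof.
move=> t0; apply: is_derive_quotient.
have : \sum_k (ptrans `|h| i k - (i == k)%:R) / `|h| *
    ptrans (Num.min t (t + h)) k j @[h --> 0^'] --> \sum_k Q i k * ptrans t k j.
  by apply: cvg_bigsum => k _; apply: cvgM;
    [exact: generator_norm|exact: ptrans_min_cvg].
apply: cvg_trans; apply: near_eq_cvg; near=> h.
have h0 : h != 0 by near: h; exact: nbhs_dnbhs_neq.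
have ht : `|h| < t by near: h; exact: dnbhs0_lt.
have main r s : 0 <= r -> 0 <= s ->
    \sum_k (ptrans r i k - (i == k)%:R) / r * ptrans s k j =
    (ptrans (r + s) i j - ptrans s i j) / r.
  move=> r0 s0; rewrite ptransD//.
  have -> : ptrans s i j = \sum_k (i == k)%:R * ptrans s k j.
    rewrite (bigD1 i)//= eqxx mul1r big1 ?addr0// => k.
    by rewrite eq_sym => /negbTE ->; rewrite mul0r.
  rewrite -sumrB mulr_suml; apply: eq_bigr => k _; ring.
have [hp|hn|] := ltgtP 0 h; last by move=> /esym/eqP; rewrite (negbTE h0).
  rewrite /= gtr0_norm// main ?ltW//; last by rewrite lt_min t0/=; lra.
  by rewrite min_l ?lerDl ?ltW// [h + t]addrC.
rewrite /= ltr0_norm// main; [|lra|]; last first.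
  by rewrite ltW// lt_min t0/=; move: ht; rewrite ltr0_norm//; lra.
rewrite min_r ?gerDl ?ltW// (_ : - h + (t + h) = t); last by ring.
by rewrite invrN mulrN -mulNr opprB.
Unshelve. all: by end_near. Qed.

Lemma ptrans_forward (t : R) i j : 0 < t ->
  is_derive t 1 (fun t : R => ptrans t i j) (\sum_k ptrans t i k * Q k j).
Proof.
move=> t0; apply: is_derive_quotient.
have : \sum_k ptrans (Num.min t (t + h)) i k *
    ((ptrans `|h| k j - (k == j)%:R) / `|h|) @[h --> 0^'] -->
    \sum_k ptrans t i k * Q k j.
  by apply: cvg_bigsum => k _; apply: cvgM;
    [exact: ptrans_min_cvg|exact: generator_norm].
apply: cvg_trans; apply: near_eq_cvg; near=> h.
have h0 : h != 0 by near: h; exact: nbhs_dnbhs_neq.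
have ht : `|h| < t by near: h; exact: dnbhs0_lt.
have main r s : 0 <= r -> 0 <= s ->
    \sum_k ptrans s i k * ((ptrans r k j - (k == j)%:R) / r) =
    (ptrans (s + r) i j - ptrans s i j) / r.
  move=> r0 s0; rewrite ptransD//.
  have -> : ptrans s i j = \sum_k ptrans s i k * (k == j)%:R.
    rewrite (bigD1 j)//= eqxx mulr1 big1 ?addr0// => k.
    by move=> /negbTE ->; rewrite mulr0.
  rewrite -sumrB mulr_suml; apply: eq_bigr => k _; ring.
have [hp|hn|] := ltgtP 0 h; last by move=> /esym/eqP; rewrite (negbTE h0).
  rewrite /= gtr0_norm// main ?ltW//; last by rewrite lt_min t0/=; lra.
  by rewrite min_l ?lerDl ?ltW.
rewrite /= ltr0_norm// main; [|lra|]; last first.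
  by rewrite ltW// lt_min t0/=; move: ht; rewrite ltr0_norm//; lra.
rewrite min_r ?gerDl ?ltW// (_ : (t + h) - h = t); last by ring.
by rewrite invrN mulrN -mulNr opprB.
Unshelve. all: by end_near. Qed.

End transition.

Lemma ge0_of_derive_ge0 (R : realType) (f df : R -> R) (t : R) :
  continuous f -> (forall x : R, 0 < x -> is_derive x 1 f (df x)) ->
  (forall x, 0 < x -> 0 <= df x) -> f 0 = 0 -> 0 <= t -> 0 <= f t.
Proof.
move=> cf fdf df0 f0 t0; rewrite -[leLHS]f0.
apply: (@ger0_derive1_le_cc _ f 0 t) => //; rewrite ?in_itv/= ?lexx ?t0//.
- by move=> x; rewrite in_itv/= => /andP[/fdf []].
- move=> x; rewrite in_itv/= => /andP[x0 _]; rewrite derive1E.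
  by have [_ ->] := fdf _ x0; exact: df0.
- exact: continuous_subspaceT.
Qed.

Lemma is_derive_mull (R : realType) (f : R -> R) (c x df : R) :
  is_derive x 1 f df -> is_derive x 1 (fun x => c * f x) (c * df).
Proof. by move=> fdf; exact: (is_deriveZ c fdf). Qed.

Definition monomial (R : realType) (l : nat) (x : R) : R := x ^+ l / l`!%:R.

Lemma monomial0 (R : realType) l : monomial l 0 = (l == 0%N)%:R :> R.
Proof. by case: l => [|l]; rewrite /monomial ?expr0 ?divr1// expr0n mul0r. Qed.

Lemma is_derive_monomial (R : realType) l (x : R) :
  is_derive x 1 (@monomial R l.+1) (monomial l x).
Proof.
rewrite /monomial.
have H : is_derive x 1 (fun x : R => x ^+ l.+1) (l.+1%:R * x ^+ l).
  have := @is_deriveX _ _ (fun x : R => x) l.+1 x 1 1 (is_derive_id _ _).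
  by rewrite exprfctE [_%:A]mulr1.
rewrite (_ : (fun _ => _) = (fun x : R => (l.+1)`!%:R^-1 * x ^+ l.+1)); last first.
  by apply/funext => y /=; rewrite mulrC.
apply: (is_derive_eq (is_derive_mull _ H)).
have lf : l`!%:R != 0 :> R by rewrite pnatr_eq0 -lt0n fact_gt0.
rewrite factS natrM; by field; rewrite lf /= addrC natr1 pnatr_eq0.
Qed.

Lemma is_derive_sum_monomial (R : realType) (a : nat -> R) m (x : R) :
  is_derive x 1 (fun x => \sum_(l < m.+1) monomial l x * a l)
    (\sum_(l < m) monomial l x * a l.+1).
Proof.
have -> : (fun x : R => \sum_(l < m.+1) monomial l x * a l) =
    (fun x => \sum_(l < m) monomial l.+1 x * a l.+1) \+ cst (a 0%N).
  apply/funext => y; rewrite big_ord_recl /= [RHS]addrC.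
  by rewrite /monomial expr0 divr1 mul1r.
rewrite -[X in is_derive _ _ _ X]addr0; apply: is_deriveD.
apply: is_derive_bigsum => l _.
rewrite (_ : (fun _ => _) = (fun x : R => a l.+1 * monomial l.+1 x)).
  by rewrite mulrC; apply: is_derive_mull; exact: is_derive_monomial.
by apply/funext => y /=; rewrite mulrC.
Qed.

Section exponential.
Context {R : realType} {S : finType}.
Variables (p : R -> S -> S -> R) (Q : S -> S -> R).
Hypotheses (ptr : transition_function p) (pQ : has_generator p Q).

Fixpoint generator_pow (l : nat) (i j : S) : R :=
  if l is l'.+1 then \sum_k Q i k * generator_pow l' k j else (i == j)%:R.

(** Induction on the order [m] of the Taylor remainder: by the backward equation
    its derivative is [Q] applied to the remainder of order [m - 1], so that the
    bound follows by integrating the inductive one. *)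
Lemma ptrans_taylor (C t : R) m i j : (forall i, \sum_k `|Q i k| <= C) ->
  0 <= t ->
  `|ptrans p t i j - \sum_(l < m) monomial l t * generator_pow l i j| <=
  C ^+ m * monomial m t.
Proof.
move=> QC; elim: m => [|m ih] in t i j *.
  move=> _; rewrite big_ord0 subr0 expr0 mul1r /monomial expr0 divr1.
  by rewrite ger0_norm ?ptrans_ge0 ?ptrans_le1.
pose rem x := ptrans p x i j - \sum_(l < m.+1) monomial l x * generator_pow l i j.
pose drem x := \sum_k Q i k *
  (ptrans p x k j - \sum_(l < m) monomial l x * generator_pow l k j).
have cS : continuous (fun x => \sum_(l < m.+1) monomial l x * generator_pow l i j).
  move=> x; apply: differentiable_continuous; apply/derivable1_diffP.
  by have [] := is_derive_sum_monomial (generator_pow ^~ i ^~ j) m x.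
have remE (x : R) : 0 < x -> is_derive x 1 rem (drem x).
  move=> x0; apply: (is_derive_eq (is_deriveB (ptrans_backward ptr pQ i j x0)
    (is_derive_sum_monomial (generator_pow ^~ i ^~ j) m x))).
  rewrite /drem; under [RHS]eq_bigr do rewrite mulrBr mulr_sumr.
  rewrite sumrB exchange_big /=; congr (_ - _); apply: eq_bigr => l _.
  by rewrite mulr_sumr; apply: eq_bigr => k _; rewrite mulrCA.
have crem : continuous rem.
  by move=> x; apply: cvgB; [exact: (ptrans_continuous ptr pQ)|exact: cS].
pose bnd (x : R) := C ^+ m.+1 * monomial m.+1 x.
have cM : continuous bnd.
  move=> x; apply: differentiable_continuous; apply/derivable1_diffP.
  by have [] := is_derive_mull (C ^+ m.+1) (is_derive_monomial m x).
have dM (x : R) : is_derive x 1 bnd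
    (C ^+ m.+1 * monomial m x).
  by apply: is_derive_mull; exact: is_derive_monomial.
have rem0 : rem 0 = 0.
  rewrite /rem (ptrans0 ptr) big_ord_recl monomial0 mul1r big1 ?addr0 ?subrr// => l _.
  by rewrite monomial0 mul0r.
have M0 : bnd 0 = 0 by rewrite /bnd monomial0 mulr0.
have le_drem x : 0 < x -> `|drem x| <= C ^+ m.+1 * monomial m x.
  move=> x0; apply: le_trans (ler_norm_sum _ _ _) _.
  rewrite exprS -mulrA.
  have mono0 : 0 <= C ^+ m * monomial m x.
    apply: mulr_ge0; last by rewrite divr_ge0 ?exprn_ge0// ltW.
    by rewrite exprn_ge0//; apply: le_trans (QC i); exact: sumr_ge0.
  apply: le_trans (ler_wpM2r mono0 (QC i)); rewrite mulr_suml.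
  apply: ler_sum => k _; rewrite normrM ler_wpM2l// ih// ltW//.
move=> t0; rewrite -[_ - _]/(rem t) ler_norml; apply/andP; split.
- rewrite -subr_ge0 opprK -[_ + _]/((rem \+ bnd) t).
  apply: (@ge0_of_derive_ge0 _ _
    (fun x => drem x + C ^+ m.+1 * monomial m x)) => //.
  + by move=> x; apply: cvgD; [exact: crem|exact: cM].
  + by move=> x x0; apply: is_deriveD; exact: remE.
  + by move=> x /le_drem; rewrite ler_norml => /andP[+ _]; rewrite -subr_ge0 opprK.
  + by rewrite /= rem0 M0 addr0.
- rewrite -subr_ge0 -[_ - _]/((bnd \- rem) t).
  apply: (@ge0_of_derive_ge0 _ _
    (fun x => C ^+ m.+1 * monomial m x - drem x)) => //.
  + by move=> x; apply: cvgB; [exact: cM|exact: crem].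
  + by move=> x x0; apply: is_deriveB; exact: remE.
  + by move=> x /le_drem; rewrite ler_norml => /andP[_]; rewrite subr_ge0.
  + by rewrite /= rem0 M0 subr0.
Qed.

Lemma ptrans_series t i j : 0 <= t ->
  series (fun l => monomial l t * generator_pow l i j) @ \oo --> ptrans p t i j.
Proof.
move=> t0; pose C := \sum_i \sum_k `|Q i k|.
have QC i' : \sum_k `|Q i' k| <= C.
  rewrite /C [leRHS](bigD1 i')//= lerDl.
  by apply: sumr_ge0 => l _; exact: sumr_ge0.
have bnd : C ^+ m * monomial m t @[m --> \oo] --> 0.
  have := @cvg_exp_coeff R (C * t); apply: cvg_trans; apply: near_eq_cvg.
  by apply: nearW => m; rewrite /exp_coeff /= exprMn mulrA.
apply/cvgrPdist_le => e e0.
move/cvgrPdist_le : bnd => /(_ _ e0); apply: filterS => m /=.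
rewrite sub0r normrN => /(le_trans (ler_norm _)); apply: le_trans.
by rewrite /series/= big_mkord; exact: ptrans_taylor.
Qed.

End exponential.

Section generator.
Context {R : realType} {S : finType}.
Variables (p : R -> S -> S -> R) (Q : S -> S -> R).
Hypotheses (ptr : transition_function p) (pQ : has_generator p Q).

Lemma generator_ge0 i j : i != j -> 0 <= Q i j.
Proof.
move=> /negbTE ij; have H := @generator_norm _ _ _ _ pQ i j.
rewrite -(cvg_lim (@Rhausdorff _) H); apply: limr_ge; first by apply/cvg_ex; exists (Q i j).
by apply: nearW => h; rewrite ij subr0 divr_ge0// ptrans_ge0.
Qed.

Lemma generator_sum0 i : \sum_j Q i j = 0.
Proof.
have H : \sum_j (ptrans p `|h| i j - (i == j)%:R) / `|h : R| @[h --> 0^'] -->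
    \sum_j Q i j.
  by apply: cvg_bigsum => j _; exact: (generator_norm pQ).
apply: (cvg_unique (@Rhausdorff _) H); apply: cvg_near_cst; apply: nearW => h.
rewrite -mulr_suml sumrB ptrans_sum// (bigD1 i)//= eqxx big1 ?addr0 ?subrr ?mul0r//.
by move=> j; rewrite eq_sym => /negbTE ->.
Qed.

End generator.

(** * Chains that move up through consecutive blocks *)

Lemma sum_block (R : realType) (S : finType) (blk : S -> nat) k m (f : 'I_m -> S)
    (g : S -> R) :
  injective f -> (forall s, blk s = k <-> exists i, s = f i) ->
  \sum_(s | blk s == k) g s = \sum_i g (f i).
Proof.
move=> finj fk.
rewrite -(@big_imset _ _ _ _ _ f (fun _ => true) g) /=; last by move=> ? ? _ _ /finj.
apply: eq_bigl => s; apply/eqP/imsetP => [/fk[i ->]|[i _ ->]]; first by exists i.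
by apply/fk; exists i.
Qed.

Section blocks.
Context {R : realType} {S : finType}.
Variables (p : R -> S -> S -> R) (Q : S -> S -> R).
Hypotheses (ptr : transition_function p) (pQ : has_generator p Q).
Variable blk : S -> nat.
Hypothesis Qblk : forall i j, Q i j != 0 -> (blk i <= blk j <= (blk i).+1)%N.
Local Notation q := (ptrans p).

Lemma generator_pow_triangular l i j : (blk j < blk i)%N ->
  generator_pow Q l i j = 0.
Proof.
elim: l i => [|l ih] i ji /=; first by case: eqP ji => [->|//]; rewrite ltnn.
rewrite big1// => k _; have [->|Qik] := eqVneq (Q i k) 0; first by rewrite mul0r.
rewrite ih ?mulr0//; apply: leq_trans ji _.
by have /andP[] := Qblk Qik.
Qed.

(** Powers of the generator never move down, and the transition function is the
    exponential series of the generator. *)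
Lemma ptrans_triangular t i j : (blk j < blk i)%N -> q t i j = 0.
Proof.
move=> ji; have m0 : 0 <= Num.max 0 t by rewrite le_max lexx.
have -> : q t i j = q (Num.max 0 t) i j by rewrite [RHS]ptransE.
have H := @ptrans_series _ _ _ _ ptr pQ _ i j m0.
apply: (cvg_unique (@Rhausdorff _) H); apply: cvg_near_cst; apply: nearW => m.
by rewrite /series/= big1// => l _; rewrite generator_pow_triangular ?mulr0.
Qed.

(** Leaving a block is irreversible, so powers of the generator, and with them
    the exponential series, restrict to each diagonal block. *)
Lemma expmx_block m (A : 'M[R]_m) (f : 'I_m -> S) k t :
  injective f -> (forall s, blk s = k <-> exists i, s = f i) ->
  (forall i j, A i j = Q (f i) (f j)) -> 0 <= t ->
  expmx (t *: A) = \matrix_(i, j) q t (f i) (f j).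
Proof.
move=> finj fk AQ t0.
have bf i : blk (f i) = k by apply/fk; exists i.
have Apow l i j : (A ^+ l) i j = generator_pow Q l (f i) (f j).
  elim: l i => [|l ih] i /=; first by rewrite expr0 mxE (inj_eq finj).
  rewrite exprS -mulmxE mxE.
  transitivity (\sum_i' Q (f i) (f i') * generator_pow Q l (f i') (f j)).
    by apply: eq_bigr => i' _; rewrite AQ ih.
  rewrite -(sum_block (fun s => Q (f i) s * generator_pow Q l s (f j)) finj fk).
  rewrite big_rmcond_in//= => s _ sk.
  have [->|/Qblk/andP[+ _]] := eqVneq (Q (f i) s) 0; first by rewrite mul0r.
  rewrite bf leq_eqVlt eq_sym (negbTE sk) /= => ks.
  by rewrite generator_pow_triangular ?mulr0// bf.
have tApow l : (t *: A) ^+ l = t ^+ l *: A ^+ l.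
  elim: l => [|l ih]; first by rewrite !expr0 scale1r.
  by rewrite !exprS ih -!mulmxE -scalemxAr -scalemxAl scalerA mulrC.
have Aser : series (fun l : nat => l`!%:R^-1 *: (t *: A) ^+ l) @ \oo -->
    \matrix_(i, j) q t (f i) (f j).
  have cij i j : (series (fun l : nat => l`!%:R^-1 *: (t *: A) ^+ l) m0 i j)
      @[m0 --> \oo] --> q t (f i) (f j).
    have := @ptrans_series _ _ _ _ ptr pQ _ (f i) (f j) t0; apply: cvg_trans.
    apply: near_eq_cvg; apply: nearW => N; rewrite /series /= summxE.
    apply: eq_bigr => l _; rewrite tApow !mxE Apow /monomial.
    by rewrite mulrA; congr (_ * _); rewrite mulrC.
  move=> B [U MU sUB]; set ser := series _.
  apply: (@filterS _ _ _ [set N | forall i j, U i j (ser N i j)]).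
    by move=> N UN; apply: sUB.
  apply: (@filter_forall nat _ (fun i N => forall j, U i j (ser N i j)) \oo _) => i.
  apply: (@filter_forall nat _ (fun j N => U i j (ser N i j)) \oo _) => j.
  by have := MU i j; rewrite mxE => /(cij i j).
apply: cvg_lim => //; exact: norm_hausdorff.
Qed.

End blocks.

Section flux.
Context {R : realType} {S : finType}.
Variables (p : R -> S -> S -> R) (Q : S -> S -> R).
Hypotheses (ptr : transition_function p) (pQ : has_generator p Q).
Variable blk : S -> nat.
Hypothesis Qblk : forall i j, Q i j != 0 -> (blk i <= blk j <= (blk i).+1)%N.
Local Notation q := (ptrans p).

Lemma ptransD_triangular s t i j : 0 <= s -> 0 <= t ->
  q (s + t) i j =
  \sum_(u | (blk i <= blk u)%N && (blk u <= blk j)%N) q s i u * q t u j.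
Proof.
move=> s0 t0; rewrite ptransD// [RHS]big_rmcond_in// => u _; rewrite negb_and -!ltnNge.
by move=> /orP[] h; rewrite (ptrans_triangular ptr pQ Qblk _ h) ?(mul0r,mulr0).
Qed.

Lemma ptransD_block s t i j : 0 <= s -> 0 <= t -> blk i = blk j ->
  q (s + t) i j = \sum_(u | blk u == blk i) q s i u * q t u j.
Proof.
move=> s0 t0 ij; rewrite ptransD_triangular//; apply: eq_bigl => u.
by rewrite -ij andbC -eqn_leq.
Qed.

Lemma ptransD_next s t i j : 0 <= s -> 0 <= t -> blk j = (blk i).+1 ->
  q (s + t) i j = \sum_(u | blk u == blk i) q s i u * q t u j +
                  \sum_(u | blk u == (blk i).+1) q s i u * q t u j.
Proof.
move=> s0 t0 ij; rewrite ptransD_triangular// (bigID (fun u => blk u == blk i)) /=.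
congr (_ + _); apply: eq_bigl => u; rewrite ij; lia.
Qed.

(** Density at time [x] of the passage from block [k] to the next one, weighted by
    the value of [g] at the state entered. *)
Definition passage (k : nat) (g : S -> R) (x : R) (s : S) : R :=
  \sum_(u | blk u == k) \sum_(v | blk v == k.+1) q x s u * Q u v * g v.

Lemma ptrans_continuousB (L : R) i j : continuous (fun x : R => q (L - x) i j).
Proof.
move=> x; have H : L - y @[y --> x] --> L - x.
  by apply: cvgB; [exact: cvg_cst|exact: cvg_id].
exact: (cvg_comp _ _ H (@ptrans_continuous _ _ _ _ ptr pQ i j (L - x))).
Qed.

Lemma is_derive_ptransB (L x : R) i j : x < L ->
  is_derive x 1 (fun x : R => q (L - x) i j) (- \sum_k Q i k * q (L - x) k j).
Proof.
move=> xL; have Lx : 0 < L - x by rewrite subr_gt0.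
have dB : is_derive x 1 (fun y : R => L - y) (- 1).
  by rewrite -[X in is_derive _ _ _ X]add0r; exact: is_deriveB.
have := @is_derive1_comp _ (fun y : R => q y i j) (fun y : R => L - y) _ _ _
  (ptrans_backward ptr pQ i j Lx) dB.
by rewrite mulrN1.
Qed.

Section next.
Variables (k : nat) (s w : S).
Hypotheses (sk : blk s = k) (wk : blk w = k.+1).

Let Phi (L x : R) : R := \sum_(v | blk v == k.+1) q x s v * q (L - x) v w.

Let is_derive_Phi (L x : R) : 0 < x < L ->
  is_derive x 1 (Phi L) (passage k (fun v => q (L - x) v w) x s).
Proof.
move=> /andP[x0 xL].
have H : is_derive x 1 (Phi L) (\sum_(v | blk v == k.+1)
    (q x s v * (- \sum_z Q v z * q (L - x) z w) +
     q (L - x) v w * (\sum_u q x s u * Q u v))).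
  apply: is_derive_bigsum => v _.
  exact: (is_deriveM (ptrans_forward ptr pQ s v x0) (is_derive_ptransB v w xL)).
apply: (is_derive_eq H); rewrite big_split /=.
set X := \sum_(v | blk v == k.+1) \sum_(u | blk u == k.+1)
  q x s u * Q u v * q (L - x) v w.
have -> : \sum_(v | blk v == k.+1) q x s v * (- \sum_z Q v z * q (L - x) z w) = - X.
  rewrite /X exchange_big /= -sumrN; apply: eq_bigr => v /eqP vk.
  rewrite mulrN mulr_sumr; congr (- _).
  rewrite [RHS]big_rmcond_in//= => [|z _ zk]; last first.
    have [->|/Qblk/andP[+ _]] := eqVneq (Q v z) 0; first by rewrite mulr0 mul0r.
    rewrite vk leq_eqVlt eq_sym (negbTE zk) /= -wk => wz.
    by rewrite (ptrans_triangular ptr pQ Qblk _ wz) !mulr0.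
  by apply: eq_bigr => z _; rewrite mulrA.
rewrite addrC /passage exchange_big /= /X -sumrB; apply: eq_bigr => v /eqP vk.
rewrite mulr_sumr (eq_bigr (fun u => q x s u * Q u v * q (L - x) v w)); last first.
  by move=> u _; rewrite mulrC.
rewrite (bigID (fun u => blk u == k.+1)) /= addrC addrK.
apply/esym; rewrite big_mkcond [RHS]big_mkcond /=; apply: eq_bigr => u _.
have [uk|uk] := eqVneq (blk u) k.
  by rewrite uk ltn_eqF.
case: ifPn => // uk1.
have [->|/Qblk/andP[]] := eqVneq (Q u v) 0; first by rewrite mulr0 mul0r.
rewrite vk ltnS leq_eqVlt (negbTE uk1) /= ltnS => a b.
by move: uk; rewrite eqn_leq a b.
Qed.

(** The integrand is the derivative of the probability [Phi] of being in [w] at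
    time [b] with the passage made by time [x]: the moves inside block [k.+1]
    cancel between the two factors of [Phi], by the forward and the backward
    equation. Among the chains in [w] at time [b], those that make the passage
    during the interval are the ones still in block [k] at time [a]. *)
Lemma integral_passage (a b : R) : 0 <= a <= b ->
  (\int[lebesgue_measure]_(x in `]a, b])
     (passage k (fun v => q (b - x) v w) x s)%:E =
  (\sum_(u | blk u == k) q a s u * q (b - a) u w)%:E)%E.
Proof.
move=> /andP[a0 ab].
have -> : \sum_(u | blk u == k) q a s u * q (b - a) u w = Phi b b - Phi b a.
  have -> : Phi b b = q (a + (b - a)) s w.
    rewrite /Phi subrr addrC subrK (bigD1 w) ?wk//= ptrans0// eqxx mulr1.
    rewrite big1 ?addr0// => v /andP[_ /negbTE vw].
    by rewrite ptrans0// vw mulr0.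
  by rewrite ptransD_next ?subr_ge0 ?wk ?sk// addrK.
have cq i j : continuous (fun x : R => q x i j) by exact: ptrans_continuous.
have cPhi : continuous (Phi b).
  move=> x; apply: cvg_bigsum => v _; apply: cvgM; first exact: cq.
  exact: ptrans_continuousB.
have cpas : continuous (fun x => passage k (fun v => q (b - x) v w) x s).
  move=> x; apply: cvg_bigsum => u _; apply: cvg_bigsum => v _; apply: cvgM.
    by apply: cvgM; [exact: cq|exact: cvg_cst].
  exact: ptrans_continuousB.
move: ab; rewrite le_eqVlt => /predU1P[->|ab].
  by rewrite set_itvoc0 integral_set0 subrr.
rewrite integral_itv_obnd_cbnd; last first.
  apply/measurable_EFinP; apply: measurable_funTS.
  exact: continuous_measurable_fun.
rewrite (@continuous_FTC2 _ _ (Phi b))//.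
- exact: continuous_subspaceT.
- split.
  + move=> x; rewrite in_itv/= => /andP[ax xb].
    by have [] := @is_derive_Phi b x; rewrite // xb (le_lt_trans a0).
  + exact/cvg_at_right_filter/cPhi.
  + exact/cvg_at_left_filter/cPhi.
- move=> x; rewrite in_itv/= => /andP[ax xb]; rewrite derive1E.
  by have [|_ ->] := @is_derive_Phi b x; rewrite // xb (le_lt_trans a0).
Qed.

End next.

(** The integrand is minus the derivative of the probability of still being in
    block [k], which decreases from [1] to [0]. *)
Lemma integral_passage_total k s : blk s = k ->
  (forall u, blk u = k -> q x s u @[x --> +oo] --> 0) ->
  (\int[lebesgue_measure]_(x in `[0%R, +oo[)
     (passage k (fun=> 1) x s)%:E = 1)%E.
Proof.
move=> sk qs0; pose F (x : R) := - \sum_(u | blk u == k) q x s u.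
have F0 : F 0 = - 1.
  rewrite /F (bigD1 s) ?sk//= ptrans0// eqxx big1 ?addr0// => u /andP[_ us].
  by rewrite ptrans0// eq_sym (negbTE us).
have dF (x : R) : 0 < x -> is_derive x 1 F (passage k (fun=> 1) x s).
  move=> x0; have H : is_derive x 1 (fun x : R => \sum_(u | blk u == k) q x s u)
      (\sum_(u | blk u == k) \sum_z q x s z * Q z u).
    by apply: is_derive_bigsum => u _; exact: ptrans_forward.
  apply: (is_derive_eq (is_deriveN H)); rewrite exchange_big /= /passage -sumrN.
  rewrite [RHS]big_mkcond /=; apply: eq_bigr => z _.
  have [zk|/eqP zk] := eqVneq (blk z) k.
    apply/eqP; rewrite -subr_eq0 -opprD oppr_eq0; apply/eqP.
    under [X in _ + X]eq_bigr do rewrite mulr1.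
    rewrite -!mulr_sumr -mulrDr; apply/eqP; rewrite mulf_eq0; apply/orP; right.
    rewrite -[X in _ == X](generator_sum0 ptr pQ z) [X in _ == X](bigID (fun u => blk u == k)) /=.
    apply/eqP; congr (_ + _).
    rewrite big_mkcond [RHS]big_mkcond /=; apply: eq_bigr => u _.
    have [uk|uk] := eqVneq (blk u) k; first by rewrite uk ltn_eqF.
    case: ifPn => // uk1.
    have [->//|/Qblk/andP[]] := eqVneq (Q z u) 0.
    rewrite zk leq_eqVlt eq_sym (negbTE uk) /= => a b.
    by move: uk1; rewrite eqn_leq a b.
  rewrite big1 ?oppr0// => u /eqP uk.
  have [->|/Qblk/andP[+ _]] := eqVneq (Q z u) 0; first by rewrite mulr0.
  rewrite uk leq_eqVlt; case: eqP => //= _; rewrite -sk => zs.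
  by rewrite (ptrans_triangular ptr pQ Qblk _ zs) mul0r.
have cq i j : continuous (fun x : R => q x i j) by exact: ptrans_continuous.
rewrite (@ge0_continuous_FTC2y _ _ F 0 0).
- by rewrite F0 sub0e -EFinN opprK.
- move=> x _; apply: sumr_ge0 => u /eqP uk; apply: sumr_ge0 => v /eqP vk.
  rewrite mulr1 mulr_ge0 ?ptrans_ge0// (generator_ge0 ptr pQ)//.
  by apply/eqP => uv; move: vk; rewrite -uv uk => /eqP; rewrite ltn_eqF.
- apply: continuous_subspaceT => x; apply: cvg_bigsum => u _; apply: cvg_bigsum => v _.
  apply: cvgM; last exact: cvg_cst.
  by apply: cvgM; [exact: cq|exact: cvg_cst].
- rewrite -oppr0; apply: cvgN.
  rewrite -[X in _ --> X](@big1_eq _ 0 +%R S (index_enum S) (fun u => blk u == k)).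
  by apply: cvg_bigsum => u /eqP uk; exact: qs0.
- by move=> x /dF[].
- apply: cvg_at_right_filter; apply: cvgN; apply: cvg_bigsum => u _; exact: cq.
- move=> x; rewrite in_itv/= andbT derive1E => x0.
  by have [_ ->] := dF _ x0.
Qed.

End flux.

Section transience.
Context {R : realType} {S : finType}.
Variables (p : R -> S -> S -> R) (Q : S -> S -> R).
Hypotheses (ptr : transition_function p) (pQ : has_generator p Q).
Local Notation q := (ptrans p).
Variable u : S.
Hypothesis uT : transient p u.

Let cq i j : continuous (fun x : R => q x i j).
Proof. exact: ptrans_continuous. Qed.

Let mq i j (D : set R) : measurable_fun D (fun x : R => (q x i j)%:E).
Proof.
apply/measurable_EFinP/measurable_funTS; exact: continuous_measurable_fun.
Qed.

(** The probability of being back in [u] within [d] is at least [1 / 2] for small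
    [d], so that the one at time [m d] is at most twice the one at any time of the
    following cell; the expected sojourn then bounds their sum over the grid. *)
Lemma transient_grid : exists2 d : R, 0 < d &
  q (m%:R * d) u u @[m --> \oo] --> 0.
Proof.
have [d d0 dq] : exists2 d : R, 0 < d & forall r : R, 0 <= r <= d -> 2^-1 <= q r u u.
  have /cvgrPdist_le/(_ 2^-1)[|e /= e0 eq] := @cq u u 0; first by rewrite invr_gt0.
  exists (e / 2); first by rewrite divr_gt0.
  move=> r /andP[r0 re]; have := eq r; rewrite /= sub0r normrN ger0_norm//.
  rewrite ptrans0// eqxx => H.
  have {}H := le_trans (ler_norm _) (H (ltac:(lra))).
  by move: H; rewrite /=; lra.
exists d => //.
pose a m := d / 2 * q (m%:R * d) u u.
have a0 m : 0 <= a m by rewrite mulr_ge0 ?ptrans_ge0 ?divr_ge0 ?ltW.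
have acvg : cvgn (series a).
  apply: nnseries_is_cvg => //.
  pose I m := `[m%:R * d, m.+1%:R * d[%classic : set R.
  have mI m : measurable (I m) by exact: measurable_itv.
  have tI : trivIset setT I.
    apply/trivIsetP => m m' _ _.
    wlog mm' : m m' / (m < m')%N => [wl|_].
      rewrite neq_ltn => /orP[mm'|mm']; last rewrite setIC.
        by apply: wl => //; rewrite ltn_eqF.
      by apply: wl => //; rewrite ltn_eqF.
    rewrite -subset0 => x []; rewrite /I /= !in_itv/= => /andP[_ xm] /andP[mx _].
    have mm2 : m.+1%:R * d <= m'%:R * d by rewrite ler_wpM2r ?(ltW d0)// ler_nat.
    by have := lt_le_trans (le_lt_trans mx xm) mm2; rewrite ltxx.
  apply: le_lt_trans uT.
  have -> : (\int[lebesgue_measure]_(t in `[0%R, +oo[) (p t u u)%:E =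
             \int[lebesgue_measure]_(t in `[0%R, +oo[) (q t u u)%:E)%E.
    by apply: eq_integral => x; rewrite inE/= in_itv/= andbT => x0; rewrite ptransE.
  have UI : (\bigcup_m I m `<=` `[0, +oo[)%classic.
    move=> x [m _]; rewrite /I /= !in_itv/= andbT => /andP[+ _]; apply: le_trans.
    by rewrite mulr_ge0// ltW.
  apply: (@le_trans _ _ (\int[lebesgue_measure]_(t in \bigcup_m I m) (q t u u)%:E)%E);
    last first.
    apply: ge0_subset_integral; [exact: bigcupT_measurable|exact: measurable_itv|
      exact: mq| |exact: UI].
    by move=> x _; rewrite lee_fin ptrans_ge0.
  rewrite ge0_integral_bigcup//; [|exact: mq|by move=> x _; rewrite lee_fin ptrans_ge0].
  apply: lee_nneseries => [m _ _|m _]; first by rewrite lee_fin.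
  have -> : (a m)%:E = (\int[lebesgue_measure]_(t in I m) (2^-1 * q (m%:R * d) u u)%:E)%E.
    rewrite integral_cst; last exact: mI.
    rewrite /I /= lebesgue_measure_itv/= lte_fin ltr_pM2r// ltr_nat ltnSn.
    by rewrite -EFinD -EFinM; congr EFin; rewrite /a -natr1; field.
  apply: ge0_le_integral; [exact: mI| |exact: measurable_cst|exact: mq|].
  - by move=> x _; rewrite lee_fin mulr_ge0// ptrans_ge0.
  - move=> x; rewrite /I /= in_itv/= => /andP[mx xm]; rewrite lee_fin.
    have xmd : 0 <= x - m%:R * d <= d.
      by move: xm; rewrite -natr1; lra.
    have md0 : 0 <= m%:R * d by rewrite mulr_ge0// ltW.
    rewrite -[in leRHS](subrK (m%:R * d) x) ptransD//; last by case/andP: xmd.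
    rewrite [leRHS](bigD1 u)//=; apply: ler_wpDr.
      by apply: sumr_ge0 => k _; rewrite mulr_ge0 ?ptrans_ge0.
    by rewrite ler_wpM2r ?ptrans_ge0// dq.
have d2 : d / 2 != 0 by rewrite gt_eqF// divr_gt0.
have : (d / 2)^-1 * a m @[m --> \oo] --> (d / 2)^-1 * 0.
  by apply: cvgM; [exact: cvg_cst|exact: cvg_series_cvg_0].
rewrite mulr0; apply: cvg_trans; apply: near_eq_cvg; apply: nearW => m.
by rewrite /= /a mulKf.
Qed.

Let amax (t : R) : S := [arg max_(s > u) q t s u]%O.
Let g (t : R) : R := q t (amax t) u.

Let le_g t s : q t s u <= g t.
Proof. by rewrite /g /amax; case: arg_maxP => // i _; exact. Qed.

Let g_ni (t h : R) : 0 <= t -> 0 <= h -> g (t + h) <= g t.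
Proof.
move=> t0 h0; rewrite {1}/g addrC ptransD//.
rewrite -[leRHS]mul1r -(ptrans_sum ptr h (amax (h + t))) mulr_suml.
by apply: ler_sum => k _; rewrite ler_wpM2l ?ptrans_ge0.
Qed.

(** The state [s] that maximizes the chance of being in [u] along infinitely many
    grid times cannot reach [u] at all: otherwise a fixed share of that chance
    would be carried by returns to [u], which become negligible. *)
Lemma transient_cvg s : q x s u @[x --> +oo] --> 0.
Proof.
have [d d0 qd0] := transient_grid.
pose a m := g (m%:R * d).
have md0 m : 0 <= m%:R * d by rewrite mulr_ge0// ltW.
have aD m r : a (m + r)%N <= a m by rewrite /a natrD mulrDl g_ni.
have ani : nonincreasing_seq a by move=> m m' mm'; rewrite -(subnKC mm') aD.
have a0 m : 0 <= a m by exact: ptrans_ge0.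
have acvg : cvgn a by apply: nonincreasing_is_cvgn => //; exists 0 => _ [m _ <-].
set L := limn a in acvg.
have La m : L <= a m by exact: nonincreasing_cvgn_ge.
have L0 : 0 <= L by apply: limr_ge => //; exact: nearW.
have {L0} L0 : L = 0.
  apply/eqP; rewrite eq_le L0 andbT leNgt; apply/negP => Lp.
  (* [S] is finite, so that one state is the maximizer infinitely often. *)
  have [s' s'P] : exists s', forall M, exists2 m, (M <= m)%N & amax (m%:R * d) = s'.
    apply: contrapT => /forallNP H.
    have {}H s' : exists M, forall m, (M <= m)%N -> amax (m%:R * d) <> s'.
      have /existsNP[M HM] := H s'; exists M => m Mm E; apply: HM; exists m => //.
    have [M HM] := choice H.
    apply: (HM (amax ((\max_i M i)%N%:R * d)) (\max_i M i)%N _ erefl).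
    exact: leq_bigmax.
  have qs0 r : q (r%:R * d) s' u = 0.
    apply/eqP; rewrite eq_le ptrans_ge0// andbT leNgt; apply/negP.
    set kap := q _ _ _ => kap0.
    have : \forall m \near \oo, q (m%:R * d) u u < L / 2 /\ a m < L + kap * L / 4.
      near=> m; split; near: m.
        have /cvgrPdist_lt/(_ (L/2)) := qd0.
        move=> /(_ (ltac:(lra))); apply: filterS => m; rewrite sub0r normrN.
        exact: le_lt_trans (ler_norm _).
      have /cvgrPdist_lt/(_ (kap * L / 4)) := acvg.
      rewrite divr_gt0 ?mulr_gt0// => /(_ erefl); apply: filterS => m.
      by rewrite distrC -ltrBlDl; exact: le_lt_trans (ler_norm _).
    move=> [N _ HN]; have [m Nm ms'] := s'P (N + r)%N.
    have [m' mE] : exists m', m = (m' + r)%N.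
      by exists (m - r)%N; rewrite subnK//; apply: leq_trans Nm; exact: leq_addl.
    have Nm' : (N <= m')%N by move: Nm; rewrite mE leq_add2r.
    have [qm am] := HN _ Nm'.
    (* The paths in [u] at time [r d] contribute the small return probability, all
       the others at most the maximum [a m']. *)
    have : a m <= kap * q (m'%:R * d) u u + (1 - kap) * a m'.
      rewrite /a /g ms' mE natrD mulrDl addrC ptransD// (bigD1 u)//= lerD2l.
      have -> : 1 - kap = \sum_(k | k != u) q (r%:R * d) s' k.
        apply/eqP; rewrite subr_eq addrC; apply/eqP.
        by have := ptrans_sum ptr (r%:R * d) s'; rewrite (bigD1 u)//= => ->.
      rewrite mulr_suml; apply: ler_sum => k _.
      by rewrite ler_wpM2l ?ptrans_ge0 ?le_g.
    have := La m; have := La m'; nra.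
  have [m _ mE] := s'P 0%N; have := La m.
  by rewrite /a /g mE qs0 leNgt Lp.
apply/cvgrPdist_le => e e0.
have /cvgrPdist_le/(_ _ e0)[N _ /(_ N (leqnn _))] := acvg.
rewrite -/L L0 /= sub0r normrN => /(le_trans (ler_norm _)) aN.
near=> x; rewrite sub0r normrN ger0_norm ?ptrans_ge0//.
apply: le_trans aN; apply: le_trans (le_g _ _) _.
have Nx : N%:R * d <= x by near: x; apply: nbhs_pinfty_ge; exact: num_real.
by rewrite -(subrK (N%:R * d) x) addrC; apply: g_ni; rewrite ?md0 ?subr_ge0.
Unshelve. all: by end_near. Qed.

End transience.

(** * Iterated integrals over tuples *)

Section tuple_integral.
Context {R : realType}.

Lemma integral_lebesgue_tuple0 (B : set (0.-tuple R)) (f : 0.-tuple R -> \bar R) :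
  B [tuple] -> (\int[lebesgue_tuple 0]_(y in B) f y = f [tuple])%E.
Proof.
move=> B0; have E : B = setT by apply/seteqP; split => // y _; rewrite (tuple0 y).
have mf : measurable_fun setT f.
  move=> _ Y mY; rewrite setTI.
  have [Yf|Yf] := pselect (Y (f [tuple])).
    by rewrite (_ : f @^-1` Y = setT)//; apply/seteqP; split => // y _ /=; rewrite (tuple0 y).
  rewrite (_ : f @^-1` Y = set0)//; apply/seteqP; split => // y /=.
  by rewrite (tuple0 y) => /Yf.
by rewrite E /= integral_dirac// diracT mul1e.
Qed.

Lemma integral_lebesgue_tupleS n (B : set (n.+1.-tuple R))
    (f : n.+1.-tuple R -> \bar R) :
  measurable B -> measurable_fun setT f -> (forall y, 0 <= f y)%E ->
  (\int[lebesgue_tuple n.+1]_(y in B) f y =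
   \int[lebesgue_measure]_x
     \int[lebesgue_tuple n]_(y in [set y | B (tuple_of_pair (x, y))])
       f (tuple_of_pair (x, y)))%E.
Proof.
move=> mB mf f0; rewrite integral_mkcond /= /lebesgue_times.
have mfB : measurable_fun setT (f \_ B).
  by apply/(measurable_restrictT _ _).1 => //; exact: measurable_funTS.
have fB0 y : (0 <= (f \_ B) y)%E by apply: erestrict_ge0.
rewrite ge0_integral_pushforward//=; last exact: measurable_tuple_of_pair.
rewrite fubini_tonelli1//=; last first.
  by apply: measurableT_comp => //; exact: measurable_tuple_of_pair.
apply: eq_integral => x _; rewrite /fubini_F [RHS]integral_mkcond.
by apply: eq_integral => y _ /=; rewrite !patchE.
Qed.

End tuple_integral.

(** * The density of the occupation times *)

(** A box [l] lists one interval [(a, b]] for each partial sum of a sequence,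
    the summation starting from [c]. *)
Fixpoint in_box (R : realType) (c : R) (l : seq (R * R)) (y : seq R) : bool :=
  match l, y with
  | (a, b) :: l', x :: y' => (a < c + x <= b) && in_box (c + x) l' y'
  | [::], [::] => true
  | _, _ => false
  end.

Fixpoint ordered_box (R : realType) (c : R) (l : seq (R * R)) : bool :=
  if l is (a, b) :: l' then (c <= a) && ordered_box b l' else true.

(** The starting point of the summation varies along the recursion, hence the
    joint statement. *)
Lemma measurable_in_box_pair (R : realType) (l : seq (R * R)) n :
  measurable [set z : measurableTypeR R * n.-tuple R | in_box z.1 l z.2].
Proof.
elim: l n => [|[a b] l ih] [|n].
- rewrite (_ : [set _ | _] = setT)//; apply/seteqP; split=> // -[c y] _ /=.
  by rewrite (tuple0 y).
- rewrite (_ : [set _ | _] = set0)//; apply/seteqP; split=> // -[c y] /=.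
  by rewrite (tuple_eta y).
- rewrite (_ : [set _ | _] = set0)//; apply/seteqP; split=> // -[c y] /=.
  by rewrite (tuple0 y).
- pose h (z : measurableTypeR R * n.+1.-tuple R) : R := z.1 + thead z.2.
  pose g (z : measurableTypeR R * n.+1.-tuple R) :
    measurableTypeR R * n.-tuple R := (h z, [tuple of behead z.2]).
  have mh : measurable_fun setT h.
    apply: measurable_funD; first exact: measurable_fst.
    by apply: (measurableT_comp (measurable_tnth ord0)); exact: measurable_snd.
  have mg : measurable_fun setT g.
    apply: measurable_fun_pair => //.
    by apply: (measurableT_comp (@measurable_behead _ _ _)); exact: measurable_snd.
  rewrite (_ : [set _ | _] = h @^-1` `]a, b] `&`
      g @^-1` [set z : measurableTypeR R * n.-tuple R | in_box z.1 l z.2]).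
    apply: measurableI.
      by rewrite -[X in measurable X]setTI; exact: mh.
    by rewrite -[X in measurable X]setTI; exact: (mg measurableT _ (ih n)).
  apply/seteqP; split => -[c y]; case/tupleP: y => x y; rewrite /g /h /= in_itv/= theadE.
    by move=> /andP[].
  by move=> [-> ->].
Qed.

Lemma measurable_in_box (R : realType) (c : R) (l : seq (R * R)) n :
  measurable [set y : n.-tuple R | in_box c l y].
Proof.
have H : measurable_fun setT (fun y : n.-tuple R => (c, y) : measurableTypeR R * n.-tuple R).
  by apply: measurable_fun_pair; [exact: measurable_cst|exact: measurable_id].
by have := H measurableT _ (@measurable_in_box_pair _ l n); rewrite setTI.
Qed.

Section density.
Context {R : realType} {S : finType}.
Variables (p : R -> S -> S -> R) (Q : S -> S -> R).
Hypotheses (ptr : transition_function p) (pQ : has_generator p Q).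
Variables (n : nat) (blk : S -> nat).
Hypothesis Qblk : forall i j, Q i j != 0 -> (blk i <= blk j <= (blk i).+1)%N.
Hypothesis blkn : forall i, (blk i <= n)%N.
Local Notation q := (ptrans p).
Local Notation passage := (passage p Q blk).

(** Conditional density of the remaining occupation times [y] when block [k] is
    entered in state [s]; this is the matrix product of the statement, read from
    the right as a column vector. *)
Fixpoint path_density (k : nat) (y : seq R) (s : S) : R :=
  if y is x :: y' then passage k (path_density k.+1 y') x s else 1.

Lemma rate_next_ge0 k u v : blk u = k -> blk v = k.+1 -> 0 <= Q u v.
Proof.
move=> uk vk; apply: (generator_ge0 ptr pQ); apply/eqP => uv.
by move: vk; rewrite -uv uk => /eqP; rewrite ltn_eqF.
Qed.

Definition passage_rate (k : nat) (x : R) (s v : S) : R :=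
  if blk v == k.+1 then \sum_(u | blk u == k) q x s u * Q u v else 0.

(** The weights are nonnegative for all states, whatever the sign of [Q] on the
    diagonal, which is what exchanging sums and integrals requires. *)
Lemma passageE k g x s : passage k g x s = \sum_v passage_rate k x s v * g v.
Proof.
rewrite -[LHS]/(\sum_(u | blk u == k) \sum_(v | blk v == k.+1) q x s u * Q u v * g v).
rewrite exchange_big /= big_mkcond; apply: eq_bigr => v _.
by rewrite /passage_rate; case: ifP => _; rewrite ?mul0r// mulr_suml.
Qed.

Lemma passage_rate_ge0 k x s v : 0 <= passage_rate k x s v.
Proof.
rewrite /passage_rate; case: ifP => // /eqP vk; apply: sumr_ge0 => u /eqP uk.
by rewrite mulr_ge0 ?ptrans_ge0// (rate_next_ge0 uk).
Qed.

Lemma measurable_passage_rate k s v : measurable_fun setT (fun x => passage_rate k x s v).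
Proof.
rewrite /passage_rate; case: (blk v == k.+1); last exact: measurable_cst.
apply: continuous_measurable_fun => x; apply: cvg_bigsum => u _.
by apply: cvgM; [exact: (ptrans_continuous ptr pQ)|exact: cvg_cst].
Qed.

Lemma path_density_ge0 k y s : 0 <= path_density k y s.
Proof.
elim: y k s => [|x y ih] k s //=; rewrite passageE.
by apply: sumr_ge0 => v _; rewrite mulr_ge0 ?passage_rate_ge0.
Qed.

Lemma measurable_path_density m k s :
  measurable_fun setT (fun y : m.-tuple R => path_density k y s).
Proof.
elim: m k s => [|m ih] k s.
  rewrite (_ : (fun _ => _) = cst 1)//; apply/funext => y.
  by rewrite (tuple0 y).
have -> : (fun y : m.+1.-tuple R => path_density k y s) =
    (fun y : m.+1.-tuple R => \sum_v passage_rate k (thead y) s v *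
       path_density k.+1 [tuple of behead y] v).
  by apply/funext => y; rewrite {1}(tuple_eta y) /= passageE.
apply: measurable_sum => v; apply: measurable_funM.
  apply: (measurableT_comp (measurable_passage_rate k s v)).
  exact: measurable_tnth.
apply: (measurableT_comp (ih k.+1 v)); exact: measurable_behead.
Qed.

Lemma integral_passage_prod m (B : set (m.-tuple R)) k x s
    (h : S -> m.-tuple R -> R) (I : S -> R) :
  measurable B -> (forall v, measurable_fun setT (h v)) -> (forall v y, 0 <= h v y) ->
  (forall v, blk v = k.+1 ->
    (\int[lebesgue_tuple m]_(y in B) (h v y)%:E = (I v)%:E)%E) ->
  (\int[lebesgue_tuple m]_(y in B) (passage k (h ^~ y) x s)%:E =
   (passage k I x s)%:E)%E.
Proof.
move=> mB mh h0 hI.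
under eq_integral do rewrite passageE -sumEFin.
have mh' v D : measurable_fun D (fun y => (h v y)%:E).
  by apply/measurable_EFinP/measurable_funTS.
rewrite ge0_integral_sum//; last 2 first.
- move=> v; apply/measurable_EFinP; apply: measurable_funM; first exact: measurable_cst.
  exact: measurable_funTS.
- by move=> v y _; rewrite lee_fin mulr_ge0 ?passage_rate_ge0.
rewrite passageE -sumEFin; apply: eq_bigr => v _.
under eq_integral do rewrite EFinM.
rewrite ge0_integralZl_EFin ?passage_rate_ge0//; last by move=> y _; rewrite lee_fin.
have [vk|vk] := eqVneq (blk v) k.+1; first by rewrite hI.
by rewrite /passage_rate (negbTE vk) mul0e mul0r.
Qed.

(** From state [s] at time [c], the probability of being in block [k + i] at time
    [a_i] and in the next block at time [b_i], for every interval [(a_i, b_i]] of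
    the box [l]. *)
Fixpoint box_prob (k : nat) (c : R) (l : seq (R * R)) (s : S) : R :=
  if l is (a, b) :: l' then
    \sum_(u | blk u == k) \sum_(w | blk w == k.+1)
      q (a - c) s u * q (b - a) u w * box_prob k.+1 b l' w
  else 1.

(** Chapman-Kolmogorov at time [c']: the chain is in block [k] at time [c] and at
    the first endpoint of [l], hence in between. For the empty box, [k] is the last
    block, which is never left. *)
Lemma box_prob_shift k c c' l s : (k + size l)%N = n -> blk s = k ->
  c <= c' -> ordered_box c' l ->
  box_prob k c l s = \sum_(w | blk w == k) q (c' - c) s w * box_prob k c' l w.
Proof.
case: l => [|[a b] l] /=.
  rewrite addn0 => kn sk cc' _; rewrite -[LHS](ptrans_sum ptr (c' - c) s).
  rewrite [RHS]big_rmcond_in /= => [|w _ wk].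
    by apply: eq_bigr => w _; rewrite mulr1.
  rewrite mulr1 (ptrans_triangular ptr pQ Qblk)// sk.
  by have := blkn w; rewrite leq_eqVlt -kn (negbTE wk).
move=> kl sk cc' /andP[ca _].
under [RHS]eq_bigr do rewrite mulr_sumr.
rewrite [RHS]exchange_big /=; apply: eq_bigr => u /eqP uk.
under [RHS]eq_bigr do rewrite mulr_sumr.
rewrite [RHS]exchange_big /=; apply: eq_bigr => w wk.
rewrite -[a - c](subrKA c') addrC (ptransD_block ptr pQ Qblk) ?subr_ge0// ?uk// sk.
rewrite !mulr_suml; apply: eq_bigr => z _; ring.
Qed.

Lemma ordered_boxW (c c' : R) l : c <= c' -> ordered_box c' l -> ordered_box c l.
Proof. by case: l => [|[a b] l]//= cc' /andP[/(le_trans cc') -> ->]. Qed.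

Lemma box_prob_ge0 k c l s : 0 <= box_prob k c l s.
Proof.
elim: l k c s => [|[a b] l ih] k c s //=.
by do 2 (apply: sumr_ge0 => ? _); rewrite !mulr_ge0 ?ptrans_ge0.
Qed.

Lemma passage_sum k (P : pred S) (F : S -> S -> R) (H : S -> R) x s :
  passage k (fun v => \sum_(w | P w) F v w * H w) x s =
  \sum_(w | P w) H w * passage k (F ^~ w) x s.
Proof.
rewrite passageE; under eq_bigr do rewrite mulr_sumr.
rewrite exchange_big /=; apply: eq_bigr => w _.
by rewrite passageE mulr_sumr; apply: eq_bigr => v _; ring.
Qed.

Lemma passage_ge0 k g x s : (forall v, 0 <= g v) -> 0 <= passage k g x s.
Proof.
move=> g0; rewrite passageE; apply: sumr_ge0 => v _.
by rewrite mulr_ge0 ?passage_rate_ge0.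
Qed.

Lemma measurable_passage_ptrans k (L : R) w s (D : set R) :
  measurable_fun D (fun x => (passage k (fun v => q (L - x) v w) x s)%:E).
Proof.
apply/measurable_EFinP/measurable_funTS.
rewrite (_ : (fun _ => _) = fun x => \sum_v passage_rate k x s v * q (L - x) v w).
  apply: measurable_sum => v; apply: measurable_funM; first exact: measurable_passage_rate.
  by apply: continuous_measurable_fun; exact: (ptrans_continuousB ptr pQ).
by apply/funext => x; rewrite passageE.
Qed.

(** The one-step identity is integrated over the first coordinate; the rest of
    the box lies beyond [b], so that its probability is carried by the state
    at time [b]. *)
Lemma integral_box m l c k s : size l = m -> (k + m)%N = n -> blk s = k ->
  ordered_box c l -> all (fun ab => ab.1 <= ab.2) l ->
  (\int[lebesgue_tuple m]_(y in [set y | in_box c l y]) (path_density k y s)%:E =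
   (box_prob k c l s)%:E)%E.
Proof.
elim: m l c k s => [|m ih] [|[a b] l] c k s //=.
  by move=> _ _ _ _ _; rewrite integral_lebesgue_tuple0.
move=> [lm] km sk /andP[ca obl] /andP[ab abl].
rewrite integral_lebesgue_tupleS; last 3 first.
- exact: (@measurable_in_box _ c ((a, b) :: l) m.+1).
- by apply/measurable_EFinP; exact: (@measurable_path_density m.+1 k s).
- by move=> y; rewrite lee_fin (@path_density_ge0 k y s).
transitivity (\int[lebesgue_measure]_(x in `](a - c)%R, (b - c)%R])
    (passage k (fun v => \sum_(w | blk w == k.+1) q (b - c - x) v w *
       box_prob k.+1 b l w) x s)%:E)%E.
  rewrite [RHS]integral_mkcond; apply: eq_integral => x _; rewrite patchE.
  case: ifPn => [|/negP xab]; last first.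
    rewrite (_ : [set _ | _] = set0) ?integral_set0//; apply/seteqP; split => // y /=.
    move=> /andP[cx _]; apply: xab; rewrite inE /= in_itv /=; lra.
  rewrite inE/= in_itv/= => xab.
  have cx : a < c + x <= b by lra.
  have -> : [set y : m.-tuple R | in_box c ((a, b) :: l) (tuple_of_pair (x, y))] =
      [set y : m.-tuple R | in_box (c + x) l y].
    by apply/seteqP; split => y /=; rewrite cx.
  rewrite [LHS](@integral_passage_prod m _ k x s (fun v y => path_density k.+1 y v)
    (fun v => box_prob k.+1 (c + x) l v)).
  - congr EFin; rewrite !passageE; apply: eq_bigr => v _.
    rewrite /passage_rate; case: ifP => [/eqP vk|]; last by rewrite !mul0r.
    congr (_ * _); rewrite (@box_prob_shift k.+1 _ b)//; last 2 first.
    + by rewrite lm addSnnS.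
    + by case/andP: cx.
    by apply: eq_bigr => w _; congr (q _ _ _ * _); ring.
  - exact: measurable_in_box.
  - by move=> v; exact: measurable_path_density.
  - by move=> v y; exact: path_density_ge0.
  - move=> v vk; apply: ih => //; first by rewrite addSnnS.
    by apply: ordered_boxW obl; case/andP: cx.
under eq_integral do rewrite passage_sum -big_filter -sumEFin.
rewrite ge0_integral_sum//; last 2 first.
- move=> w; apply/measurable_EFinP; apply: measurable_funM; first exact: measurable_cst.
  by apply/measurable_EFinP; exact: measurable_passage_ptrans.
- move=> w x _; rewrite lee_fin mulr_ge0 ?box_prob_ge0// passage_ge0// => v.
  exact: ptrans_ge0.
rewrite exchange_big /= -[in RHS]big_filter -sumEFin big_seq [RHS]big_seq.
apply: eq_bigr => w; rewrite mem_filter => /andP[/eqP wk _].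
under eq_integral do rewrite EFinM.
rewrite ge0_integralZl_EFin ?box_prob_ge0//; last 2 first.
- by move=> x _; rewrite lee_fin passage_ge0// => v; exact: ptrans_ge0.
- exact: measurable_passage_ptrans.
rewrite (integral_passage ptr pQ Qblk sk wk); last by lra.
rewrite -EFinM; congr EFin; rewrite mulrC mulr_suml; apply: eq_bigr => u _.
by rewrite opprB addrA subrK.
Qed.

(** The two choices of [Z] used below, the closed and the open half-line, show
    that the boundary of the orthant has no mass. *)
Lemma integral_orthant (b : bool) m k s :
  let Z := [set` Interval (BSide b (0 : R)) +oo%O] in
  (forall u, (blk u < n)%N -> transient p u) -> (k + m)%N = n -> blk s = k ->
  (\int[lebesgue_tuple m]_(y in [set y : m.-tuple R | {in tval y, forall x, Z x}])
     (path_density k y s)%:E = 1)%E.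
Proof.
move=> Z tr; have mZ : measurable Z by exact: measurable_itv.
have mB i : measurable [set y : i.-tuple R | {in tval y, forall x, Z x}].
  rewrite (_ : [set _ | _] = \bigcap_(j in [set: 'I_i]) (@tnth _ _ ^~ j @^-1` Z)).
    apply: fin_bigcap_measurable => // j _; rewrite -[X in measurable X]setTI.
    exact: measurable_tnth.
  apply/seteqP; split => y /=.
    by move=> H j _ /=; apply: H; exact: mem_tnth.
  by move=> H x /tnthP[j ->]; exact: H.
elim: m k s => [|m ih] k s km sk.
  by rewrite integral_lebesgue_tuple0//= => x; rewrite inE.
rewrite integral_lebesgue_tupleS//; last 2 first.
- by apply/measurable_EFinP; exact: (@measurable_path_density m.+1 k s).
- by move=> y; rewrite lee_fin (@path_density_ge0 k y s).
transitivity (\int[lebesgue_measure]_(x in Z) (passage k (fun=> 1) x s)%:E)%E.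
  rewrite [RHS]integral_mkcond; apply: eq_integral => x _; rewrite patchE.
  case: ifPn => [|/negP xZ]; last first.
    rewrite (_ : [set _ | _] = set0) ?integral_set0//; apply/seteqP; split => // y /=.
    by move=> H; apply: xZ; rewrite inE; apply: H; rewrite mem_head.
  rewrite inE => xZ.
  have -> : [set y : m.-tuple R | [set y : m.+1.-tuple R | {in tval y, forall x, Z x}]
        (tuple_of_pair (x, y))] = [set y : m.-tuple R | {in tval y, forall x, Z x}].
    apply/seteqP; split => y /= H z zy; first by apply: H; rewrite in_cons zy orbT.
    by move: zy; rewrite in_cons => /orP[/eqP->//|]; exact: H.
  rewrite (@integral_passage_prod m _ k x s (fun v y => path_density k.+1 y v) (fun=> 1))//.
  - by move=> v; exact: measurable_path_density.
  - by move=> v y; exact: path_density_ge0.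
  - by move=> v vk; apply: ih => //; rewrite addSnnS.
have tot := integral_passage_total ptr pQ Qblk sk.
have {}tot : (\int[lebesgue_measure]_(x in `[0%R, +oo[) (passage k (fun=> 1) x s)%:E = 1)%E.
  apply: tot => u uk; apply: (transient_cvg ptr pQ); apply: tr.
  by rewrite uk -km addnS ltnS leq_addr.
rewrite /Z; case: b @Z mZ mB ih => Z mZ mB ih; first exact: tot.
rewrite integral_itv_obnd_cbnd//; apply/measurable_EFinP/measurable_funTS.
rewrite (_ : (fun _ => _) = fun x => \sum_v passage_rate k x s v * 1).
  by apply: measurable_sum => v; apply: measurable_funM => //; exact: measurable_passage_rate.
by apply/funext => x; rewrite passageE.
Qed.

End density.

(** * Finite-dimensional distributions and paths of a jump process *)

Lemma measure_partition (d : measure_display) (T : measurableType d) (R : realType)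
    (mu : {measure set T -> \bar R}) (S : finType) (h : T -> S) (E : set T) :
  measurable E -> (forall u, measurable [set w | h w = u]) ->
  (mu E = \sum_u mu (E `&` [set w | h w = u]))%E.
Proof.
move=> mE mh; rewrite fsbig_seq; last exact: index_enum_uniq.
rewrite -measure_fin_bigcup//.
- congr (mu _); apply/seteqP; split => w; last by move=> [u _ []].
  by move=> Ew; exists (h w) => //; rewrite /= mem_index_enum.
- by move=> u v _ _ [w [[_ <-] [_ <-]]].
- by move=> u _; exact: measurableI.
Qed.

Lemma measure_eq_mod_negligible (d : measure_display) (T : measurableType d)
    (R : realType) (mu : {measure set T -> \bar R}) (E F N : set T) :
  measurable E -> measurable F -> mu.-negligible N ->
  (forall w, ~ N w -> E w <-> F w) -> mu E = mu F.
Proof.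
move=> mE mF [N' [mN' N0 NN']].
have sub (X Y : set T) : measurable X -> measurable Y ->
    (forall w, ~ N w -> X w -> Y w) -> (mu X <= mu Y)%E.
  move=> mX mY XY; rewrite -[leRHS]adde0 -N0.
  apply: le_trans (measureU2 _ mY mN'); apply: le_measure; rewrite ?inE//.
    exact: measurableU.
  move=> w Xw; have [/NN' Nw|/XY] := pselect (N w); first by right.
  by left; auto.
by move=> EF; apply/eqP; rewrite eq_le !sub// => w /EF[].
Qed.

Section process.
Context {R : realType} {S : finType} {d : measure_display} {T : measurableType d}.
Variables (P : probability T R) (phi : R -> T -> S) (pi : S -> R).
Variable p : R -> S -> S -> R.
Hypothesis mjp : markov_jump_process P phi pi p.

Let mphi t i : 0 <= t -> measurable [set w | phi t w = i].
Proof. exact: mjp_measurable mjp t i. Qed.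

Let mphiB t (B : pred S) : 0 <= t -> measurable [set w | B (phi t w)].
Proof.
move=> t0; rewrite (_ : [set _ | _] = \bigcup_(i in [set i | B i]) [set w | phi t w = i]).
  by apply: fin_bigcup_measurable => // i _; exact: mphi.
by apply/seteqP; split=> [w /= Bw|w [i Bi /= ->]//]; exists (phi t w).
Qed.

Definition observed (L : seq (R * pred S)) : set T :=
  [set w | all (fun tB => tB.2 (phi tB.1 w)) L].

Fixpoint increasing_from (c : R) (L : seq (R * pred S)) : bool :=
  if L is (t, _) :: L' then (c <= t) && increasing_from t L' else true.

Fixpoint observed_prob (c : R) (s : S) (L : seq (R * pred S)) : R :=
  if L is (t, B) :: L' then
    \sum_(u | B u) ptrans p (t - c) s u * observed_prob t u L'
  else 1.

Lemma observed_prob_ge0 c s L : 0 <= observed_prob c s L.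
Proof.
elim: L c s => [|[t B] L ih] c s //=; apply: sumr_ge0 => u _.
by rewrite mulr_ge0 ?ptrans_ge0//; exact: mjp_transition mjp.
Qed.

Lemma measurable_observed c L : 0 <= c -> increasing_from c L ->
  measurable (observed L).
Proof.
elim: L c => [|[t B] L ih] c c0 /=.
  by rewrite /observed (_ : [set _ | _] = setT)//; apply/seteqP; split.
move=> /andP[ct iL]; have t0 := le_trans c0 ct.
rewrite (_ : observed _ = [set w | B (phi t w)] `&` observed L).
  by apply: measurableI; [exact: mphiB|exact: ih iL].
apply/seteqP; split => w; rewrite /observed /=; first by move=> /andP[].
by move=> [-> ->].
Qed.

Let past (hist : seq (R * S)) : set T := [set w | forall x, x \in hist -> phi x.1 w = x.2].

Let measurable_past hist c : (forall x, x \in hist -> 0 <= x.1 <= c) ->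
  measurable (past hist).
Proof.
elim: hist => [|[t i] hist ih] hc.
  by rewrite /past (_ : [set _ | _] = setT)//; apply/seteqP; split.
rewrite (_ : past _ = [set w | phi t w = i] `&` past hist).
  apply: measurableI.
    by apply: mphi; have := hc (t, i); rewrite mem_head => /(_ isT) /= /andP[].
  by apply: ih => x xh; apply: hc; rewrite in_cons xh orbT.
apply/seteqP; split => w /=.
  move=> H; split; first by apply: (H (t, i)); rewrite mem_head.
  by move=> x xh; apply: H; rewrite in_cons xh orbT.
by move=> [pt H] x; rewrite in_cons => /orP[/eqP->//|]; exact: H.
Qed.

(** Each observation in turn becomes part of the history, so that the Markov
    property applies to the next one. *)
Let observedE hist c s L : (forall x, x \in hist -> 0 <= x.1 <= c) -> 0 <= c ->
  increasing_from c L ->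
  (P ((past hist `&` [set w | phi c w = s]) `&` observed L) =
   P (past hist `&` [set w | phi c w = s]) * (observed_prob c s L)%:E)%E.
Proof.
elim: L hist c s => [|[t B] L ih] hist c s hc c0 /=.
  by move=> _; rewrite mule1 (_ : observed [::] = setT) ?setIT//; apply/seteqP; split.
move=> /andP[ct iL]; have t0 := le_trans c0 ct.
have mpast := measurable_past hc.
have mh : measurable (past hist `&` [set w | phi c w = s]).
  by apply: measurableI => //; exact: mphi.
have mobs : measurable (observed ((t, B) :: L)).
  by apply: (measurable_observed c0); rewrite /= ct.
rewrite (@measure_partition _ _ _ P S (phi t)); last 2 first.
- exact: measurableI.
- by move=> u; exact: mphi.
rewrite (bigID B) /= [X in (_ + X)%E]big1 ?adde0 => [|u Bu]; last first.
  rewrite [X in P X](_ : _ = set0) ?measure0//; apply/seteqP; split => // w.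
  by move=> [[_ +] /= pu]; rewrite /observed /= pu (negbTE Bu).
rewrite -sumEFin ge0_sume_distrr => [|u _]; last first.
  rewrite lee_fin mulr_ge0 ?observed_prob_ge0 ?ptrans_ge0//.
  exact: mjp_transition mjp.
apply: eq_bigr => u Bu.
have hc' x : x \in (c, s) :: hist -> 0 <= x.1 <= t.
  rewrite in_cons => /orP[/eqP->/=|/hc/andP[-> xc]]; first by rewrite c0.
  by rewrite (le_trans xc).
transitivity (P ((past ((c, s) :: hist) `&` [set w | phi t w = u]) `&` observed L)).
  congr (P _); apply/seteqP; split => w.
    move=> [[[pw cw]]]; rewrite /observed /= => /andP[_ Lw] tw.
    by do ?split => //; move=> x; rewrite in_cons => /orP[/eqP->//|/pw].
  move=> [[pw tw] Lw]; do ?split => //.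
  - by move=> x xh; apply: pw; rewrite in_cons xh orbT.
  - by apply: (pw (c, s)); rewrite mem_head.
  - by rewrite /observed /= tw Bu.
rewrite ih// EFinM muleA; congr (_ * _)%E.
rewrite ptransE ?subr_ge0//.
have := mjp_markov mjp (hist := hist) (s := c) (t := t) s u hc.
rewrite c0 ct => /(_ isT) <-; congr (P _); apply/seteqP; split => w.
  move=> [pw tw]; split => //.
    by move=> x xh; apply: pw; rewrite in_cons xh orbT.
  by apply: (pw (c, s)); rewrite mem_head.
move=> [pw cw tw]; split => // x; rewrite in_cons => /orP[/eqP->//|]; exact: pw.
Qed.

Lemma observed_probE L : increasing_from 0 L ->
  (P (observed L) = (\sum_s pi s * observed_prob 0 s L)%:E)%E.
Proof.
move=> iL; rewrite (@measure_partition _ _ _ P S (phi 0)); last 2 first.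
- exact: measurable_observed iL.
- by move=> u; exact: mphi.
rewrite -sumEFin; apply: eq_bigr => s _.
have past0 : past [::] = setT by apply/seteqP; split.
have := @observedE [::] 0 s L _ (lexx 0) iL; rewrite past0 setTI => H.
transitivity (P ([set w | phi 0 w = s] `&` observed L)); first by rewrite setIC.
rewrite EFinM H//; congr (_ * _)%E; exact: mjp_initial mjp s.
Qed.

(** Right end of the cell of mesh [1 / m.+1] containing [s]. *)
Definition grid (m : nat) (s : R) : R :=
  (Num.trunc (s * m.+1%:R)).+1%:R / m.+1%:R.

Lemma phi_grid w s : 0 <= s -> \forall m \near \oo, phi (grid m s) w = phi s w.
Proof.
move=> s0; have [[e /= e0 eP] _] := mjp_paths mjp w s0.
have [N _ HN] := near_infty_natSinv_lt (PosNum e0).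
exists N => // m Nm; have {}HN := HN m Nm.
have m0 : 0 < m.+1%:R :> R by rewrite ltr0n.
have sm0 : 0 <= s * m.+1%:R by rewrite mulr_ge0.
have /andP[t1 t2] := truncn_itv sm0.
have gs : s < grid m s by rewrite /grid ltr_pdivlMr.
apply: eP => //=; rewrite ltr0_norm ?subr_lt0// opprB ltrBlDr.
apply: (@le_lt_trans _ _ (m.+1%:R^-1 + s)); last by rewrite ltrD2r.
by rewrite /grid ler_pdivrMr// mulrDl mulVf ?gt_eqF// -natr1 addrC lerD2l.
Qed.

(** By right-continuity the state at time [s] is the eventual state at the grid
    points just after [s], so that the joint event is the lower limit of countable
    unions of rectangles. *)
Lemma measurable_joint i :
  measurable [set z : measurableTypeR R * T | 0 <= z.1 /\ phi z.1 z.2 = i].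
Proof.
pose E m := [set z : measurableTypeR R * T | 0 <= z.1 /\ phi (grid m z.1) z.2 = i].
have mE m : measurable (E m).
  have m0 : 0 < m.+1%:R :> R by rewrite ltr0n.
  rewrite (_ : E m = \bigcup_j (`[j%:R / m.+1%:R, j.+1%:R / m.+1%:R[%classic `*`
      [set w | phi (j.+1%:R / m.+1%:R) w = i])).
    apply: bigcupT_measurable => j; apply: measurableX; first exact: measurable_itv.
    by apply: mphi; rewrite divr_ge0.
  apply/seteqP; split => -[s w] /=.
    move=> [/= s0 gi]; exists (Num.trunc (s * m.+1%:R)) => //.
    have /andP[t1 t2] := @truncn_itv _ (s * m.+1%:R) (mulr_ge0 s0 (ltW m0)).
    by split=> //=; rewrite in_itv /= ler_pdivrMr// ltr_pdivlMr// t1.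
  move=> [j _ [/=]]; rewrite in_itv /= ler_pdivrMr// ltr_pdivlMr// => js ji.
  split=> /=; last by rewrite /grid (truncn_def js).
  rewrite -(pmulr_lge0 _ m0); apply: le_trans (ler0n _ j) _; by case/andP: js.
rewrite (_ : [set _ | _] = \bigcup_N \bigcap_(m in [set m | (N <= m)%N]) E m).
  apply: bigcupT_measurable => N; apply: bigcap_measurable => //.
  by exists N => /=.
apply/seteqP; split => -[s w].
  move=> [/= s0 si]; have [N _ HN] := phi_grid w s0.
  by exists N => // m /= Nm; split => //=; rewrite HN.
move=> [N _ HN]; have [/= s0 _] := HN N (leqnn N); split => //=.
have [N' _ HN'] := phi_grid w s0.
rewrite -(HN' (maxn N N') (leq_maxr _ _)) /=.
by have [] := HN (maxn N N') (leq_maxl _ _).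
Qed.

Definition sojourn (B : pred S) (w : T) : set R := [set s | 0 <= s /\ B (phi s w)].

Let measurable_jointB (B : pred S) :
  measurable [set z : measurableTypeR R * T | 0 <= z.1 /\ B (phi z.1 z.2)].
Proof.
rewrite (_ : [set _ | _] = \bigcup_(i in [set i | B i])
    [set z : measurableTypeR R * T | 0 <= z.1 /\ phi z.1 z.2 = i]).
  by apply: fin_bigcup_measurable => // i _; exact: measurable_joint.
apply/seteqP; split => -[s w]; first by move=> [s0 Bs]; exists (phi s w).
by move=> [i /= Bi [s0 /= ->]].
Qed.

Let sojournE B w : sojourn B w =
  ysection [set z : measurableTypeR R * T | 0 <= z.1 /\ B (phi z.1 z.2)] w.
Proof. by rewrite ysectionE; apply/seteqP; split. Qed.

Lemma measurable_sojourn B w : measurable (sojourn B w : set (measurableTypeR R)).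
Proof. by rewrite sojournE; exact: measurable_ysection. Qed.

Lemma measurable_sojourn_time B :
  measurable_fun setT (fun w => lebesgue_measure (sojourn B w)).
Proof.
have := measurable_fun_ysection (@lebesgue_measure R) (measurable_jointB B).
by congr (measurable_fun _ _); apply/funext => w; rewrite /= sojournE.
Qed.

Lemma Rintegral_sojourn (B : pred S) w :
  \int[lebesgue_measure]_(s in `[0, +oo[) (B (phi s w))%:R =
  fine (lebesgue_measure (sojourn B w)).
Proof.
rewrite /Rintegral; congr fine.
rewrite (_ : sojourn B w = sojourn B w `&` `[0, +oo[%classic); last first.
  by apply/esym/setIidl => s [s0 _] /=; rewrite in_itv /= s0.
rewrite -integral_indic//; last exact: measurable_sojourn.
apply: eq_integral => s; rewrite inE/= in_itv/= andbT => s0; congr EFin.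
by rewrite indicE; congr (nat_of_bool _)%:R; apply/idP/idP; rewrite inE /sojourn /= => // -[].
Qed.

End process.

(** * Reading the occupation times off a nondecreasing path *)

Lemma in_box_gt0 (R : realType) (c : R) l y : ordered_box c l -> in_box c l y ->
  all (fun x => 0 < x) y.
Proof.
elim: l c y => [|[a b] l ih] c [|x y] //= /andP[ca obl] /andP[/andP[ax xb] bl].
apply/andP; split; first by rewrite -(ltrD2l c) addr0 (le_lt_trans ca).
exact: ih (ordered_boxW xb obl) bl.
Qed.

Section clock.
Context {R : realType}.
Variable N : R -> nat.
Hypothesis N_nd : forall s t, 0 <= s <= t -> (N s <= N t)%N.
Hypothesis N_rc : forall t, 0 <= t -> \forall s \near t^'+, N s = N t.

Let O j : set (measurableTypeR R) := [set s | 0 <= s /\ N s == j].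
Hypothesis mO : forall j, measurable (O j).

Let Y j : R := fine (lebesgue_measure (O j)).

(** The times at which a nondecreasing path is at a level at most [k] form an
    interval starting at [0], whose length is the sum of the sojourns; it does not
    contain its right end because the path is right-continuous. *)
Lemma leave_time k : (forall j, (j <= k)%N -> (lebesgue_measure (O j) < +oo)%E) ->
  forall t, 0 <= t -> (N t <= k)%N = (t < \sum_(j < k.+1) Y j).
Proof.
move=> Ofin t t0.
pose L i : set (measurableTypeR R) := [set s | 0 <= s /\ (N s <= i)%N].
have LS i : L i.+1 = L i `|` O i.+1.
  apply/seteqP; split => s; rewrite /L /O /=.
    by move=> [s0]; rewrite leq_eqVlt ltnS => /orP[]; [right|left].
  by move=> [[-> /leqW ->//]|[-> /eqP->]].
have mL i : measurable (L i).
  elim: i => [|i ih]; last by rewrite LS; exact: measurableU.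
  by rewrite (_ : L 0%N = O 0%N)//; apply/seteqP; split=> s; rewrite /L /O /= leqn0.
have Lk i : (i <= k)%N -> lebesgue_measure (L i) = (\sum_(j < i.+1) Y j)%:E.
  elim: i => [|i ih] ik.
    rewrite big_ord1 /Y fineK; last by rewrite ge0_fin_numE// Ofin.
    by congr (lebesgue_measure _); apply/seteqP; split=> s; rewrite /L /O /= leqn0.
  transitivity (lebesgue_measure (L i) + lebesgue_measure (O i.+1))%E.
    rewrite LS; apply: measureU => //; rewrite -subset0 => s [[_ /= Ni] [_ /eqP Ni1]].
    by move: Ni; rewrite Ni1 ltnn.
  rewrite ih ?(ltnW ik)// -[X in (_ + X)%E]fineK; last first.
    by rewrite ge0_fin_numE// Ofin.
  by rewrite -EFinD [in RHS]big_ord_recr.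
apply/idP/idP => [Nt|].
  have [t' tt' Nt'] : exists2 t', t < t' & N t' = N t.
    have [e /= e0 eN] := N_rc t0.
    exists (t + e / 2); first by rewrite ltrDl divr_gt0.
    apply: eN; rewrite /= ?ltrDl ?divr_gt0// opprD addNKr normrN gtr0_norm ?divr_gt0//.
    lra.
  apply: (lt_le_trans tt'); rewrite -lee_fin -Lk//.
  have t'0 : 0 <= t' := le_trans t0 (ltW tt').
  have -> : (t'%:E = lebesgue_measure (`[0%R, t']%classic : set (measurableTypeR R)))%E.
    rewrite lebesgue_measure_itv /= lte_fin.
    by have [t'p|t'n] := ltP 0 t'; rewrite ?oppr0 ?adde0//; congr EFin; lra.
  apply: le_measure; rewrite ?inE//.
  move=> s /=; rewrite in_itv /= => /andP[s0 st']; split => //=.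
  by apply: leq_trans Nt; rewrite -Nt'; apply: N_nd; rewrite s0.
apply: contraLR; rewrite -ltnNge -leNgt => kN.
rewrite -lee_fin -Lk//.
apply: (@le_trans _ _ (lebesgue_measure (`[0%R, t]%classic : set (measurableTypeR R)))).
  apply: le_measure; rewrite ?inE//.
  move=> s [s0 Ns]; rewrite /= in_itv /= s0 leNgt; apply/negP => ts.
  have := leq_trans kN (N_nd _ : (N t <= N s)%N).
  by rewrite t0 ltW// => /(_ isT); rewrite ltnNge Ns.
rewrite lebesgue_measure_itv /= lte_fin.
by case: ifP => _; rewrite ?oppr0 ?adde0// lee_fin.
Qed.

Fixpoint level_observations (k : nat) (l : seq (R * R)) : bool :=
  if l is (a, b) :: l' then
    [&& N a == k, N b == k.+1 & level_observations k.+1 l']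
  else true.

Variable n : nat.
Hypothesis N_le : forall t, (N t <= n)%N.

Let in_box_observations k l m : size l = m -> (k + m)%N = n ->
  (forall j, (j < n)%N -> forall t, 0 <= t -> (N t <= j)%N = (t < \sum_(i < j.+1) Y i)) ->
  0 <= \sum_(i < k) Y i -> ordered_box (\sum_(i < k) Y i) l ->
  all (fun ab => ab.1 <= ab.2) l ->
  in_box (\sum_(i < k) Y i) l [seq Y i | i <- iota k m] = level_observations k l.
Proof.
move=> + + clock; elim: m k l => [|m ih] k [|[a b] l] //= [lm] km ck0.
move=> /andP[cka obl] /andP[/= ab abl].
have kn : (k < n)%N by rewrite -km addnS ltnS leq_addr.
have ckS : \sum_(i < k) Y i + Y k = \sum_(i < k.+1) Y i by rewrite big_ord_recr.
rewrite ckS; have a0 := le_trans ck0 cka.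
have kNa : (k <= N a)%N.
  by case: (k) kn cka => // k' /ltnW k'n ck'; rewrite ltnNge clock// -leNgt.
have Nak : (N a == k) = (a < \sum_(i < k.+1) Y i) by rewrite -clock// eqn_leq kNa andbT.
have Y0 i : 0 <= Y i by rewrite fine_ge0.
have ckS0 : 0 <= \sum_(i < k.+1) Y i by exact: sumr_ge0.
rewrite Nak -andbA; congr (_ && _).
have [ckb|bck] := leP (\sum_(i < k.+1) Y i) b; last first.
  apply/esym/negbTE; rewrite negb_and; apply/orP; left.
  have := bck; rewrite -clock// ?(le_trans a0)// => Nbk.
  by rewrite neq_ltn ltnS Nbk.
have b0 := le_trans ckS0 ckb.
have kNb : (k < N b)%N by rewrite ltnNge clock// -leNgt.
rewrite /= ih//; last 2 first.
- by rewrite addSnnS.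
- by apply: ordered_boxW obl.
case E : (level_observations _ _); last by rewrite andbF.
rewrite andbT; apply/esym/eqP/eqP; rewrite eqn_leq kNb andbT.
move: kn; rewrite leq_eqVlt => /predU1P[->//|k1n].
case: l m lm km ih obl abl E => [|[a' b'] l] [|m] //= lm km ih.
  by move: k1n; rewrite -km addn1 ltnn.
move=> /andP[ba' _] _ /and3P[/eqP Na' _ _].
by rewrite -Na'; apply: N_nd; rewrite b0.
Qed.

Let observed_left k l c : 0 <= c -> ordered_box c l ->
  all (fun ab => ab.1 <= ab.2) l -> level_observations k l ->
  forall j, (k <= j < k + size l)%N -> exists2 b, 0 <= b & N b = j.+1.
Proof.
elim: l k c => [|[a b] l ih] k c c0 /=.
  by move=> _ _ _ j; rewrite addn0 => /andP[/leq_ltn_trans h /h]; rewrite ltnn.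
move=> /andP[ca obl] /andP[ab abl] /and3P[_ /eqP Nb lo] j /andP[].
have b0 : 0 <= b by apply: le_trans ab; exact: le_trans ca.
rewrite leq_eqVlt => /predU1P[<- _|kj]; first by exists b.
by rewrite addnS -addSn => jk; apply: (ih k.+1 b) => //; rewrite kj.
Qed.

(** Once the sojourns are finite, both sides say when each level is left, by
    [leave_time]. They are finite on either side: all coordinates of a point of the
    box are positive, whereas [fine] sends an infinite sojourn to [0]; and a level
    that has been left has a bounded sojourn. *)
Lemma in_box_levels l : size l = n -> ordered_box 0 l ->
  all (fun ab => ab.1 <= ab.2) l ->
  in_box 0 l [seq Y i | i <- iota 0 n] = level_observations 0 l.
Proof.
move=> ln obl abl.
have equiv : (forall j, (j < n)%N -> (lebesgue_measure (O j) < +oo)%E) ->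
    in_box 0 l [seq Y i | i <- iota 0 n] = level_observations 0 l.
  move=> Ofin; have := @in_box_observations 0 l n ln (add0n n).
  rewrite big_ord0; apply => // j jn t t0; apply: leave_time => // i ij.
  by apply: Ofin; exact: leq_ltn_trans jn.
apply/idP/idP => H.
  rewrite -equiv// => j jn; have := in_box_gt0 obl H.
  rewrite all_map => /allP/(_ j); rewrite mem_iota add0n jn => /(_ isT) /=.
  by rewrite /Y ltey; apply: contraTneq => ->; rewrite /= ltxx.
rewrite equiv// => j jn; have [|b b0 Nb] := observed_left (lexx 0) obl abl H (j := j).
  by rewrite ln.
apply: (@le_lt_trans _ _ (lebesgue_measure (`[0%R, b]%classic : set (measurableTypeR R)))).
  apply: le_measure; rewrite ?inE//.
  move=> s [s0 /eqP Ns]; rewrite /= in_itv /= s0 leNgt; apply/negP => bs.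
  by have := N_nd (s := b) (t := s); rewrite b0 ltW// => /(_ isT); rewrite Nb Ns ltnn.
rewrite lebesgue_measure_itv /= lte_fin.
by case: ifP => _; rewrite ?oppr0 ?adde0 ltry.
Qed.

End clock.

(** * The law of the occupation times on boxes *)

Section occupation.
Context {R : realType} {S : finType} {d : measure_display} {T : measurableType d}.
Variables (P : probability T R) (phi : R -> T -> S) (pi : S -> R).
Variables (p : R -> S -> S -> R) (Q : S -> S -> R).
Hypothesis mjp : markov_jump_process P phi pi p.
Hypothesis pQ : has_generator p Q.
Variables (n : nat) (blk : S -> nat).
Hypothesis Qblk : forall i j, Q i j != 0 -> (blk i <= blk j <= (blk i).+1)%N.
Hypothesis blkn : forall i, (blk i <= n)%N.
Let ptr := mjp_transition mjp.

Let backward_negligible s t : 0 <= s <= t ->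
  P.-negligible [set w | (blk (phi t w) < blk (phi s w))%N].
Proof.
move=> /andP[s0 st]; have t0 := le_trans s0 st.
have mst u : measurable [set w | (phi s w, phi t w) = u].
  rewrite (_ : [set _ | _] = [set w | phi s w = u.1] `&` [set w | phi t w = u.2]).
    by apply: measurableI; apply: (mjp_measurable mjp).
  by case: u => i j; apply/seteqP; split=> w /=; case=> -> ->.
have mE : measurable [set w | (blk (phi t w) < blk (phi s w))%N].
  rewrite (_ : [set _ | _] = \bigcup_(u in [set u : S * S | (blk u.2 < blk u.1)%N])
      [set w | (phi s w, phi t w) = u]).
    by apply: fin_bigcup_measurable => // u _; exact: mst.
  apply/seteqP; split => w /=; first by move=> H; exists (phi s w, phi t w).
  by move=> [[i j] /= ij [-> ->]].
exists [set w | (blk (phi t w) < blk (phi s w))%N]; split => //.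
rewrite (@measure_partition _ _ _ P _ (fun w => (phi s w, phi t w)))// big1// => -[i j] _.
have [ji|ij] := ltnP (blk j) (blk i); last first.
  have -> : [set w | (blk (phi t w) < blk (phi s w))%N] `&`
      [set w | (phi s w, phi t w) = (i, j)] = set0.
    by apply/seteqP; split => // w /= [+ [pi' pj]]; rewrite pi' pj ltnNge ij.
  exact: measure0.
have := @mjp_markov _ _ _ _ _ _ _ _ mjp [::] s t i j.
rewrite s0 st => /(_ _ isT) H.
have -> : [set w | (blk (phi t w) < blk (phi s w))%N] `&`
    [set w | (phi s w, phi t w) = (i, j)] =
    [set w | [/\ forall x, x \in [::] -> phi x.1 w = x.2, phi s w = i & phi t w = j]].
  by apply/seteqP; split => w /=; [move=> [_ [-> ->]]|move=> [_ -> ->]].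
apply: etrans (H _) _ => //; rewrite -ptransE ?subr_ge0//.
by rewrite (ptrans_triangular ptr pQ Qblk _ ji) mule0.
Qed.

(** By right-continuity, it is enough to compare the path at grid points. *)
Let nonmonotone_negligible :
  P.-negligible [set w | ~ forall s t, 0 <= s <= t -> (blk (phi s w) <= blk (phi t w))%N].
Proof.
pose F m j j' := [set w | (j <= j')%N /\
  (blk (phi (j'%:R / m.+1%:R) w) < blk (phi (j%:R / m.+1%:R) w))%N].
apply: (@negligibleS _ _ _ _ (\bigcup_m \bigcup_j \bigcup_j' F m j j')).
  move=> w /= /existsNP[s /existsNP[t /not_implyP[/andP[s0 st] /negP]]].
  rewrite -ltnNge => ts; have t0 := le_trans s0 st.
  have [m [ms mt]] : exists m, phi (grid m s) w = phi s w /\ phi (grid m t) w = phi t w.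
    have [N1 _ H1] := phi_grid mjp w s0; have [N2 _ H2] := phi_grid mjp w t0.
    exists (maxn N1 N2); split; first exact: H1 (leq_maxl _ _).
    exact: H2 (leq_maxr _ _).
  exists m => //; exists (Num.trunc (s * m.+1%:R)).+1 => //.
  exists (Num.trunc (t * m.+1%:R)).+1 => //; split.
    by rewrite ltnS; apply: le_truncn; rewrite ler_wpM2r.
  by rewrite -!/(grid _ _) ms mt.
apply: negligible_bigcup => m; apply: negligible_bigcup => j.
apply: negligible_bigcup => j'; rewrite /F.
have [jj'|jj'] := leqP j j'; last first.
  apply: (@negligibleS _ _ _ _ set0); last exact: negligible_set0.
  by move=> w [].
have st : 0 <= (j%:R / m.+1%:R : R) <= j'%:R / m.+1%:R.
  apply/andP; split; first by rewrite divr_ge0.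
  by rewrite ler_pM2r ?invr_gt0 ?ltr0n// ler_nat.
by apply: negligibleS (backward_negligible st) => w [].
Qed.

Definition level_times (w : T) : n.-tuple R :=
  [tuple fine (lebesgue_measure (sojourn phi (fun s => blk s == k) w)) | k < n].

Lemma measurable_level_times : measurable_fun setT level_times.
Proof.
apply/measurable_fun_tnthP => k.
rewrite (_ : _ \o _ =
  fun w => fine (lebesgue_measure (sojourn phi (fun s => blk s == k) w))).
  apply: measurableT_comp => //; exact: (measurable_sojourn_time mjp).
by apply/funext => w; rewrite /= tnth_mktuple.
Qed.

Fixpoint box_observations (k : nat) (l : seq (R * R)) : seq (R * pred S) :=
  if l is (a, b) :: l' then
    (a, fun s => blk s == k) :: (b, fun s => blk s == k.+1) :: box_observations k.+1 l'
  else [::].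

(** Almost every path is nondecreasing, so that the box event amounts to finitely
    many observations, whose probability is given by the Markov property. *)
Lemma level_times_in_box l : size l = n -> ordered_box 0 l ->
  all (fun ab => ab.1 <= ab.2) l ->
  (P [set w | in_box 0 l (level_times w)] =
   (\sum_s pi s * box_prob p blk 0 0 l s)%:E)%E.
Proof.
move=> ln obl abl.
have obsE k w l' : level_observations (fun t => blk (phi t w)) k l' =
    all (fun tB => tB.2 (phi tB.1 w)) (box_observations k l').
  by elim: l' k => [|[a b] l' ih] k //=; rewrite -ih.
have inc c k l' : ordered_box c l' -> all (fun ab => ab.1 <= ab.2) l' ->
    increasing_from c (box_observations k l').
  elim: l' c k => [|[a b] l' ih] c k //= /andP[-> obl'] /andP[-> abl'] /=.
  exact: ih.
have probE c k l' s : observed_prob p c s (box_observations k l') = box_prob p blk k c l' s.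
  elim: l' c k s => [|[a b] l' ih] c k s //=; apply: eq_bigr => u _.
  by rewrite mulr_sumr; apply: eq_bigr => w _; rewrite ih mulrA.
under eq_bigr do rewrite -probE.
rewrite -(observed_probE mjp); last exact: inc.
apply: (measure_eq_mod_negligible _ _ nonmonotone_negligible).
- by have := measurable_level_times measurableT (@measurable_in_box _ 0 l n); rewrite setTI.
- by apply: (measurable_observed mjp (lexx 0)); exact: inc.
move=> w /contrapT mono; rewrite /observed /= -obsE.
rewrite -(@in_box_levels _ (fun t => blk (phi t w)) _ _ _ n)//.
- rewrite [tval _](_ : _ = [seq fine (lebesgue_measure
    [set s | 0 <= s /\ blk (phi s w) == i]) | i <- iota 0 n]) //.
  by rewrite /= -val_enum_ord -map_comp.
- move=> t t0; have [H _] := mjp_paths mjp w t0.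
  by apply: filterS H => s ->.
- by move=> j; exact: (measurable_sojourn mjp (fun s => blk s == j) w).
Qed.

End occupation.

(** * Boxes determine a law on the open orthant *)

Section grid_boxes.
Context {R : realType}.
Implicit Types (c x e : R) (l : seq (R * R)) (y : seq R) (m : nat) (js : seq nat).

Definition grid_box m js : seq (R * R) :=
  [seq (j%:R / m.+1%:R, j.+1%:R / m.+1%:R) | j : nat <- js].

Let m0 m : 0 < m.+1%:R :> R. Proof. by rewrite ltr0n. Qed.

Lemma grid_cell m x : 0 < x -> exists j : nat, j%:R / m.+1%:R < x <= j.+1%:R / m.+1%:R.
Proof.
move=> x0; have [j xj jmin] : exists2 j : nat, x <= j.+1%:R / m.+1%:R &
    forall i : nat, x <= i.+1%:R / m.+1%:R -> (j <= i)%N.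
  have ex : exists j : nat, x <= j.+1%:R / m.+1%:R.
    exists (Num.trunc (x * m.+1%:R)); rewrite ler_pdivlMr// ltW//.
    by have /andP[] := @truncn_itv _ (x * m.+1%:R) (mulr_ge0 (ltW x0) (ltW (m0 m))).
  by case: (ex_minnP ex) => j xj jmin; exists j.
exists j; rewrite xj andbT; case: j xj jmin => [|j] xj jmin; first by rewrite mul0r.
by rewrite ltNge; apply/negP => /jmin; rewrite ltnn.
Qed.

Lemma grid_box_exists m c y : 0 <= c -> all (fun x => 0 < x) y ->
  exists2 js, size js = size y & in_box c (grid_box m js) y.
Proof.
elim: y c => [|x y ih] c c0 /=; first by exists [::].
move=> /andP[x0 y0]; have cx : 0 < c + x by rewrite ltr_wpDl.
have [j jP] := grid_cell m cx; have [js sjs bjs] := ih _ (ltW cx) y0.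
by exists (j :: js); rewrite /= ?sjs// jP bjs.
Qed.

(** A point whose coordinates exceed the mesh has partial sums in distinct cells. *)
Lemma grid_box_ordered m c y js (i : nat) : i%:R / m.+1%:R <= c + m.+1%:R^-1 ->
  all (fun x => m.+1%:R^-1 < x) y -> in_box c (grid_box m js) y ->
  ordered_box (i%:R / m.+1%:R) (grid_box m js).
Proof.
elim: js c y i => [|j js ih] c [|x y] i //= ic /andP[mx my] /andP[/andP[jc cj] bjs].
apply/andP; split; last first.
  by apply: (ih _ _ _ _ my bjs); rewrite -natr1 mulrDl mul1r lerD2r ltW.
rewrite ler_pM2r ?invr_gt0// ler_nat -ltnS -(ltr_nat R) -(ltr_pM2r (_ : 0 < m.+1%:R^-1 :> R)).
  by apply: le_lt_trans ic _; apply: lt_le_trans cj; rewrite ltrD2l.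
by rewrite invr_gt0.
Qed.

Lemma in_box_close e c c' l y y' : 0 < e -> all (fun ab => ab.2 - ab.1 <= e) l ->
  `|c - c'| < e -> in_box c l y -> in_box c' l y' ->
  forall k, (k < size y)%N -> `|nth 0 y k - nth 0 y' k| < 2 * e.
Proof.
move=> e0; elim: l c c' y y' => [|[a b] l ih] c c' [|x y] [|x' y'] //=.
move=> /andP[ab abl] cc' /andP[/andP[ax xb] yl] /andP[/andP[ax' xb'] yl'].
have d : `|c + x - (c' + x')| < e by rewrite ltr_norml; apply/andP; split; lra.
case=> [_|k] /=; last by rewrite ltnS; exact: ih d yl yl' k.
by move: cc' d; rewrite !ltr_norml => /andP[? ?] /andP[? ?]; apply/andP; split; lra.
Qed.

Definition box_meet l l' : seq (R * R) :=
  [seq (Num.max u.1.1 u.2.1, Num.min u.1.2 u.2.2) | u <- zip l l'].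

Lemma in_box_meet c l l' y : size l = size l' ->
  in_box c (box_meet l l') y = in_box c l y && in_box c l' y.
Proof.
elim: l l' c y => [|[a b] l ih] [|[a' b'] l'] c [|x y] //= [ll].
rewrite -/(box_meet l l') ih// gt_max le_min.
by case: (a < _); case: (a' < _); case: (_ <= b); case: (_ <= b'); rewrite //= ?andbF.
Qed.

Lemma ordered_box_meet c c' l l' : size l = size l' ->
  ordered_box c l -> ordered_box c' l' ->
  ordered_box (Num.min c c') (box_meet l l').
Proof.
elim: l l' c c' => [|[a b] l ih] [|[a' b'] l'] c c' //= [ll] /andP[ca bl] /andP[ca' bl'].
rewrite -/(box_meet l l') ih// andbT.
by rewrite le_max ge_min ca.
Qed.

End grid_boxes.

Section box_uniqueness.
Context {R : realType} {n : nat}.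
Variables m1 m2 : {measure set (n.-tuple R) -> \bar R}.

Definition open_orthant : set (n.-tuple R) := [set y | all (fun x => 0 < x) y].

Let box (l : seq (R * R)) : set (n.-tuple R) := [set y | in_box 0 l y].

Hypothesis m12 : forall l, size l = n -> ordered_box 0 l ->
  all (fun ab => ab.1 <= ab.2) l -> m1 (box l) = m2 (box l).
Hypothesis m1T : m1 setT = 1%E.
Hypotheses (m2C : m2 open_orthant = 1%E) (m2T : m2 setT = 1%E).

Lemma measurable_open_orthant : measurable open_orthant.
Proof.
rewrite (_ : open_orthant = \bigcap_(j in [set: 'I_n]) (@tnth _ _ ^~ j @^-1` `]0, +oo[)).
  apply: fin_bigcap_measurable => // j _; rewrite -[X in measurable X]setTI.
  exact: measurable_tnth.
apply/seteqP; split => y /=.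
  by move=> /all_tnthP H j _ /=; rewrite in_itv /= H.
by move=> H; apply/all_tnthP => j; have := H j I; rewrite /= in_itv /= andbT.
Qed.
Let mC := measurable_open_orthant.

Let mbox l : measurable (box l).
Proof. exact: measurable_in_box. Qed.

Let box_sub l : ordered_box 0 l -> box l `<=` open_orthant.
Proof. by move=> ol y; exact: in_box_gt0. Qed.

(** Ordered boxes, together with everything off the orthant so as to cover. *)
Let G : set (set (n.-tuple R)) := [set X |
  (exists l, [/\ size l = n, ordered_box 0 l & X = box l]) \/
  (measurable X /\ X `&` open_orthant = set0)].

Let Gm : G `<=` measurable.
Proof. by move=> X [[l [_ _ ->]]|[]]. Qed.

Let setIG : setI_closed G.
Proof.
move=> X X' [[l [sl ol ->]]|[mX XC]] [[l' [sl' ol' ->]]|[mX' XC']].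
- left; exists (box_meet l l'); split.
  + by rewrite size_map size_zip sl sl' minnn.
  + by rewrite -[0]minxx; apply: ordered_box_meet; rewrite ?sl.
  + by apply/seteqP; split=> y; rewrite /box /= in_box_meet ?sl//; move/andP.
- by right; split; [exact: measurableI|rewrite -setIA XC' setI0].
- by right; split; [exact: measurableI|rewrite setIAC XC set0I].
- by right; split; [exact: measurableI|rewrite -setIA XC' setI0].
Qed.

Let good (k : nat * seq nat) := (size k.2 == n) && ordered_box 0 (@grid_box R k.1 k.2).

Let g (i : nat) : set (n.-tuple R) :=
  if unpickle i is Some k then
    if good k then box (@grid_box R k.1 k.2) else ~` open_orthant
  else ~` open_orthant.

Let Gg i : G (g i).
Proof.
have GC : G (~` open_orthant).
  by right; split; [exact: measurableC|rewrite setICl].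
rewrite /g; case: unpickle => // k; case: ifP => // /andP[/eqP sk ok].
by left; exists (@grid_box R k.1 k.2); rewrite size_map.
Qed.

Let gE k : g (pickle k) = if good k then box (@grid_box R k.1 k.2) else ~` open_orthant.
Proof. by rewrite /g pickleK. Qed.

Let good_box (y : n.-tuple R) (e : R) : open_orthant y -> 0 < e ->
  exists k, [/\ good k, box (@grid_box R k.1 k.2) y & k.1.+1%:R^-1 < e].
Proof.
move=> yC e0.
have [d d0 dy] : exists2 d : R, 0 < d & all (fun x => d < x) y.
  move: yC; rewrite /open_orthant /=; elim: (tval y) => [|x s ih] /=; first by exists 1.
  move=> /andP[x0 /ih[d d0 ds]]; exists (Num.min (x / 2) d).
    by rewrite lt_min d0 divr_gt0.
  rewrite gt_min (_ : x / 2 < x) /=; last by lra.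
  by apply: sub_all ds => z; rewrite gt_min orbC => ->.
have ed0 : 0 < Num.min e d by rewrite lt_min e0.
have [N _ /(_ N (leqnn N)) /=] := near_infty_natSinv_lt (PosNum ed0).
rewrite lt_min => /andP[Ne Nd].
have [js sjs bjs] := @grid_box_exists _ N 0 y (lexx 0) yC.
exists (N, js); split => //; rewrite /good /= sjs size_tuple eqxx /=.
have -> : 0 = 0%:R / N.+1%:R :> R by rewrite mul0r.
apply: grid_box_ordered bjs; first by rewrite mul0r add0r invr_ge0.
by apply: sub_all dy => z; exact: lt_trans.
Qed.

Let g_cover : \bigcup_i g i = setT.
Proof.
apply/seteqP; split => // y _; have [yC|yC] := pselect (open_orthant y).
  have [k [gk ky _]] := good_box yC ltr01.
  by exists (pickle k) => //; rewrite gE gk.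
exists (pickle (0%N, nseq n.+1 0%N)) => //.
by rewrite gE /good /= size_nseq gtn_eqF.
Qed.

Let sG_measurable : measurable `<=` <<s G >>.
Proof.
pose gT := g_sigma_algebraType G.
have sG_sub X : G X -> @measurable _ gT X by exact: sub_sigma_algebra.
suff mid : measurable_fun [set: gT] (fun y : gT => (y : n.-tuple R)).
  by move=> B mB; have := mid measurableT B mB; rewrite setTI.
apply/measurable_fun_tnthP => k.
apply: (measurability _ (@RGenInftyO.measurableE R)) => _ [_ [x ->] <-].
pose X : set (n.-tuple R) := [set y | tnth y k < x].
rewrite setTI (_ : _ @^-1` _ = X); last first.
  by apply/seteqP; split => y; rewrite /X /= in_itv.
have mX : measurable X.
  have := @measurable_tnth _ (measurableTypeR R) n k measurableT `]-oo, x[%classic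
    (measurable_itv _).
  by rewrite setTI; congr measurable; apply/seteqP; split => y; rewrite /X /= in_itv.
have -> : X = (X `\` open_orthant) `|`
    \bigcup_i (if `[< g i `<=` X `&` open_orthant >] then g i else set0).
  apply/seteqP; split => y; last first.
    move=> [[]//|[i _]]; case: ifP => [/asboolP h /h[]|]//.
  move=> Xy; have [yC|yC] := pselect (open_orthant y); [right|by left].
  have yx : 0 < (x - tnth y k) / 2.
    by rewrite divr_gt0// subr_gt0.
  have [i [gi iy ie]] := good_box yC yx.
  exists (pickle i) => //; rewrite gE gi; case: ifP => // /asboolP[] z zi.
  split; last by apply: (box_sub _ zi); case/andP: gi.
  rewrite /X /=.
  have := @in_box_close _ (i.1.+1%:R^-1) 0 0 (@grid_box R i.1 i.2) y z.
  rewrite invr_gt0 ltr0n subrr normr0 => /(_ isT).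
  have -> : all (fun ab => ab.2 - ab.1 <= i.1.+1%:R^-1) (@grid_box R i.1 i.2).
    by rewrite all_map; apply/allP => j _ /=; rewrite -mulrBl -natr1 addrC addKr mul1r.
  rewrite invr_gt0 ltr0n => /(_ isT isT iy zi k); rewrite size_tuple ltn_ord => /(_ isT).
  rewrite -!tnth_nth ltr_norml => /andP[+ _].
  by move: ie; set e := _^-1; lra.
apply: (@measurableU _ gT).
  by apply: sG_sub; right; split; [exact: measurableD|rewrite setDE -setIA setICl setI0].
by apply: (@bigcupT_measurable _ gT) => i; case: ifP => // _; exact: sG_sub.
Qed.

(** Ordered boxes are stable under intersection, and those with endpoints on
    grids are countably many and generate the Borel sets of the orthant. The total
    masses then rule out any mass off the orthant. *)
Lemma box_measure_unique B : measurable B -> m1 B = m2 B.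
Proof.
have r12 A : measurable A -> mrestr m1 mC A = mrestr m2 mC A.
  move=> mA; apply: (@g_sigma_algebra_measure_unique _ _ _ G Gm g Gg g_cover) => //.
  - move=> X [[l [sl ol ->]]|[mX XC]]; last by rewrite /= /mrestr XC !measure0.
    rewrite /= /mrestr setIidl; last exact: box_sub.
    have [al|al] := boolP (all (fun ab => ab.1 <= ab.2) l); first exact: m12.
    rewrite (_ : box l = set0) ?measure0//; apply/seteqP; split => // y.
    move: al; rewrite /box /=; move: (tval y) (0 : R) => {sl ol} s.
    elim: l s => [|[a b] l ih] [|x s] c //=; rewrite negb_and => /orP[|/ih H].
      by rewrite -ltNge => ba /andP[/andP[ax /(lt_le_trans ax)/ltW]]; rewrite leNgt ba.
    by move=> /andP[_ /H].
  - move=> k; apply: (@le_lt_trans _ _ (m1 setT)); last by rewrite m1T ltry.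
    by apply: le_measure; rewrite ?inE//; apply: measurableI => //; exact: Gm.
  - exact: sG_measurable.
have C12 : m1 open_orthant = m2 open_orthant.
  by have := r12 setT measurableT; rewrite /mrestr !setTI.
have null (mu : {measure set (n.-tuple R) -> \bar R}) : mu open_orthant = 1%E ->
    mu setT = 1%E -> mu (~` open_orthant) = 0%E.
  move=> muC muT; have : (mu setT = mu (setT `\` open_orthant) + mu (setT `&` open_orthant))%E.
    exact: measureDI.
  rewrite setTI muC muT setTD.
  have fC : mu (~` open_orthant) \is a fin_num.
    rewrite ge0_fin_numE//; apply: (@le_lt_trans _ _ (mu setT)); last by rewrite muT ltry.
    by apply: le_measure; rewrite ?inE//; exact: measurableC.
  by rewrite -(fineK fC) -EFinD => -[] /eqP; rewrite -subr_eq subrr => /eqP <-.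
move=> mB.
have split (mu : {measure set (n.-tuple R) -> \bar R}) : mu open_orthant = 1%E ->
    mu setT = 1%E -> mu B = mrestr mu mC B.
  move=> muC muT; have -> : (mu B = mu (B `\` open_orthant) + mrestr mu mC B)%E.
    exact: measureDI.
  suff -> : mu (B `\` open_orthant) = 0%E by rewrite add0e.
  apply: (subset_measure0 _ _ _ (null _ muC muT)).
  - exact: measurableD.
  - exact: measurableC.
  - by move=> y [].
by rewrite split ?C12// (split m2)// r12.
Qed.

End box_uniqueness.

(** * Identification of the law *)

(** The proofs are arguments so that the measure structure can be inferred. *)
Definition density_measure (d : measure_display) (T : measurableType d) (R : realType)
    (mu : {measure set T -> \bar R}) (f : T -> R) (mf : measurable_fun setT f)
    (f0 : forall x, 0 <= f x) (B : set T) : \bar R := (\int[mu]_(x in B) (f x)%:E)%E.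

Section density_measure.
Context {d : measure_display} {T : measurableType d} {R : realType}.
Variables (mu : {measure set T -> \bar R}) (f : T -> R).
Hypotheses (mf : measurable_fun setT f) (f0 : forall x, 0 <= f x).
Local Notation nu := (density_measure mu mf f0).

Let density_measure0 : nu set0 = 0%E.
Proof. exact: integral_set0. Qed.

Let density_measure_ge0 B : (0 <= nu B)%E.
Proof. by apply: integral_ge0 => x _; rewrite lee_fin. Qed.

Let density_measure_sigma_additive : semi_sigma_additive nu.
Proof.
move=> F mF tF mUF; rewrite /density_measure ge0_integral_bigcup//; last 2 first.
- by apply/measurable_EFinP; exact: measurable_funTS.
- by move=> x _; rewrite lee_fin.
by apply: is_cvg_nneseries => i _ _; exact: density_measure_ge0.
Qed.

HB.instance Definition _ := isMeasure.Build _ _ _ nu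
  density_measure0 density_measure_ge0 density_measure_sigma_additive.

End density_measure.

Section law.
Context {R : realType} {S : finType} {d : measure_display} {T : measurableType d}.
Variables (P : probability T R) (phi : R -> T -> S) (pi : S -> R).
Variables (p : R -> S -> S -> R) (Q : S -> S -> R).
Hypothesis mjp : markov_jump_process P phi pi p.
Hypothesis pQ : has_generator p Q.
Variables (n : nat) (blk : S -> nat).
Hypothesis Qblk : forall i j, Q i j != 0 -> (blk i <= blk j <= (blk i).+1)%N.
Hypothesis blkn : forall i, (blk i <= n)%N.
Hypothesis transient_blk : forall u, (blk u < n)%N -> transient p u.
Hypothesis pi_blk : forall s, blk s != 0%N -> pi s = 0.
Let ptr := mjp_transition mjp.

Definition start_density (y : seq R) : R := \sum_s pi s * path_density p Q blk 0 y s.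

Definition occupation_density (y : n.-tuple R) : R :=
  if [forall i, 0 <= tnth y i] then start_density y else 0.

Let pi_ge0 s : 0 <= pi s.
Proof. by rewrite -lee_fin -(mjp_initial mjp). Qed.

Let pi_sum : \sum_s pi s = 1.
Proof.
apply: EFin_inj; rewrite -(probability_setT P).
rewrite (@measure_partition _ _ _ P S (phi 0))//; last first.
  by move=> u; exact: (mjp_measurable mjp).
rewrite -sumEFin; apply: eq_bigr => s _; rewrite setTI.
by apply/esym; exact: (mjp_initial mjp).
Qed.

Lemma start_density_ge0 y : 0 <= start_density y.
Proof.
apply: sumr_ge0 => s _; rewrite mulr_ge0//; exact: (path_density_ge0 ptr pQ).
Qed.

Lemma measurable_start_density :
  measurable_fun setT (fun y : n.-tuple R => start_density y).
Proof.
apply: measurable_sum => s; apply: measurable_funM; first exact: measurable_cst.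
exact: (measurable_path_density ptr pQ).
Qed.

Let orthant (b : bool) : set (n.-tuple R) :=
  [set y | {in tval y, forall x, [set` Interval (BSide b (0 : R)) +oo%O] x}].

Let measurable_orthant b : measurable (orthant b).
Proof.
rewrite (_ : orthant b = \bigcap_(j in [set: 'I_n])
    (@tnth _ _ ^~ j @^-1` [set` Interval (BSide b (0 : R)) +oo%O])).
  apply: fin_bigcap_measurable => // j _; rewrite -[X in measurable X]setTI.
  by apply: measurable_tnth => //; exact: measurable_itv.
apply/seteqP; split => y /=; first by move=> H j _ /=; apply: H; exact: mem_tnth.
by move=> H x /tnthP[j ->]; exact: H.
Qed.

Let occupation_densityE : occupation_density =
  (fun y : n.-tuple R => start_density y) \_ (orthant true).
Proof.
apply/funext => y; rewrite patchE /occupation_density; congr (if _ then _ else _).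
apply/forallP/idP => [H|]; rewrite inE.
  by move=> x /tnthP[j ->] /=; rewrite in_itv /= andbT.
by move=> H j; have := H _ (mem_tnth j y); rewrite /= in_itv /= andbT.
Qed.

Lemma occupation_density_ge0 y : 0 <= occupation_density y.
Proof. by rewrite /occupation_density; case: ifP => // _; exact: start_density_ge0. Qed.

Lemma measurable_occupation_density : measurable_fun setT occupation_density.
Proof.
rewrite occupation_densityE; apply/(measurable_restrictT _ (measurable_orthant true)).
by apply: measurable_funTS; exact: measurable_start_density.
Qed.

Let integral_start (B : set (n.-tuple R)) (I : S -> R) : measurable B ->
  (forall s, blk s = 0%N ->
    \int[lebesgue_tuple n]_(y in B) (path_density p Q blk 0 y s)%:E = (I s)%:E)%E ->
  (\int[lebesgue_tuple n]_(y in B) (start_density y)%:E = (\sum_s pi s * I s)%:E)%E.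
Proof.
move=> mB BI; rewrite /start_density.
under eq_integral do rewrite -sumEFin.
rewrite ge0_integral_sum//; last 2 first.
- move=> s; apply/measurable_EFinP; apply: measurable_funM; first exact: measurable_cst.
  by apply: measurable_funTS; exact: (measurable_path_density ptr pQ).
- by move=> s y _; rewrite lee_fin mulr_ge0//; exact: (path_density_ge0 ptr pQ).
rewrite -sumEFin; apply: eq_bigr => s _.
under eq_integral do rewrite EFinM.
rewrite ge0_integralZl_EFin//; last 2 first.
- by move=> y _; rewrite lee_fin; exact: (path_density_ge0 ptr pQ).
- apply/measurable_EFinP; apply: measurable_funTS; exact: (measurable_path_density ptr pQ).
have [s0|s0] := eqVneq (blk s) 0%N; first by rewrite BI.
by rewrite pi_blk// mul0e mul0r.
Qed.

Let integral_start_orthant b :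
  (\int[lebesgue_tuple n]_(y in orthant b) (start_density y)%:E = 1)%E.
Proof.
rewrite (@integral_start _ (fun=> 1))//; last first.
  by move=> s s0; apply: (integral_orthant ptr pQ Qblk b transient_blk) => //.
by under eq_bigr do rewrite mulr1; rewrite pi_sum.
Qed.

(** The two measures agree on ordered boxes; the total mass of the density is [1],
    already on the open orthant, so that they agree everywhere. *)
Lemma law_occupation_density (m1 : {measure set (n.-tuple R) -> \bar R}) :
  (forall B, measurable B -> m1 B = P (level_times phi n blk @^-1` B)) ->
  forall B, measurable B ->
  m1 B = (\int[lebesgue_tuple n]_(y in B) (occupation_density y)%:E)%E.
Proof.
move=> m1P B mB.
pose m2 := density_measure (lebesgue_tuple n) measurable_occupation_density
  occupation_density_ge0.
have occE b : {in orthant b, occupation_density =1 start_density}.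
  move=> y; rewrite inE => yb; rewrite occupation_densityE patchE mem_set// => x xy.
  have := yb x xy; rewrite /= !in_itv /= !andbT; case: (b) => //; exact: ltW.
have openE : open_orthant = orthant false.
  apply/seteqP; split => y; rewrite /open_orthant /orthant /=.
    by move=> /allP H x /H; rewrite /= in_itv /= andbT.
  by move=> H; apply/allP => x /H; rewrite /= in_itv /= andbT.
have m2E b : m2 (orthant b) = 1%E.
  rewrite -(integral_start_orthant b); apply: eq_integral => y yb.
  by rewrite (occE b).
apply: (@box_measure_unique _ _ m1 m2) => //.
- move=> l ln obl abl; rewrite m1P; last exact: measurable_in_box.
  rewrite -[in LHS]/[set w | in_box 0 l (level_times phi n blk w)].
  rewrite (level_times_in_box mjp pQ Qblk blkn ln obl abl).
  rewrite -(@integral_start [set y : n.-tuple R | in_box 0 l y]); last 2 first.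
  + exact: measurable_in_box.
  + by move=> s s0; apply: (integral_box ptr pQ Qblk blkn) => //; rewrite add0n.
  apply: eq_integral => y; rewrite inE => /= yl; rewrite (occE false)//.
  by rewrite inE -openE; exact: in_box_gt0 yl.
- by rewrite m1P// preimage_setT probability_setT.
- by rewrite openE.
- rewrite -(m2E true) /m2 /density_measure [RHS]integral_mkcond.
  apply: eq_integral => y _; rewrite patchE; case: ifPn => // yb.
  by rewrite occupation_densityE patchE (negbTE yb).
Qed.

End law.

(** * Multivariate phase-type parameters *)

Section phase_type.
Context {R : realType}.
Variables (n : nat) (dim : nat -> nat).
Variable alpha : 'rV[R]_(dim 0%N).
Variable A : forall k, 'M[R]_(dim k).
Variable D : forall k, 'M[R]_(dim k, dim k.+1).
Let S := mph_state n dim.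
Let Q : S -> S -> R := mph_generator A D (n := n).
Let pi : S -> R := mph_initial alpha (n := n).

Definition mph_level (s : mph_state n dim) : nat := if s is Some u then val (tag u) else n.

Let state (k : nat) (kn : (k < n)%N) (i : 'I_(dim k)) : S :=
  Some (existT (fun k : 'I_n => 'I_(dim k)) (Ordinal kn) i).

Let state_inj k (kn : (k < n)%N) : injective (state kn).
Proof. by move=> i j /Some_inj/eqP; rewrite -!/(Tagged _ _) eq_Tagged => /eqP. Qed.

Let state_level k (kn : (k < n)%N) s : mph_level s = k <-> exists i, s = state kn i.
Proof.
split; last by move=> [i ->].
case: s => [[l i]|] /=; last by move=> nk; exfalso; move: kn; rewrite -nk ltnn.
move=> lk; have E : l = Ordinal kn by exact: val_inj.
by subst l; exists i.
Qed.

Lemma mph_level_le s : (mph_level s <= n)%N.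
Proof. by case: s => [[k i]|] //=; exact: ltnW. Qed.

Lemma mph_generator_level s s' : Q s s' != 0 ->
  (mph_level s <= mph_level s' <= (mph_level s).+1)%N.
Proof.
rewrite /Q; case: s => [[k i]|]; last by rewrite eqxx.
case: s' => [[l j]|] /=.
  case: eqP => [e _|_]; first by rewrite e leqnn leqnSn.
  by case: eqP => [e _|_]; [rewrite e leqnn leqnSn|rewrite eqxx].
by case: ifP => [/eqP e _|_]; [rewrite -[X in (_ <= X <= _)%N]e leqnSn leqnn|rewrite eqxx].
Qed.

Let cast_ord_idE m (e : m = m) (i : 'I_m) : cast_ord e i = i.
Proof. exact: val_inj. Qed.

Let Q_state k (kn : (k < n)%N) i j : Q (state kn i) (state kn j) = A k i j.
Proof. by rewrite /Q /=; case: eqP => // e; rewrite cast_ord_idE. Qed.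

Let Q_next k (kn : (k < n)%N) (k1n : (k.+1 < n)%N) i j :
  Q (state kn i) (state k1n j) = D k i j.
Proof.
rewrite /Q /=; case: eqP => [e|_]; first by have := ltnn k; rewrite -{2}e leqnn.
by case: eqP => // e; rewrite cast_ord_idE.
Qed.

Let Q_exit k (kn : (k < n)%N) i : k.+1 = n ->
  Q (state kn i) None = (D k *m const_mx 1 : 'cV[R]_(dim k)) i ord0.
Proof. by move=> /eqP k1n; rewrite /Q /= k1n. Qed.

Lemma mph_initial_level s : mph_level s != 0%N -> pi s = 0.
Proof.
by rewrite /pi; case: s => [[k i]|] //= k0; case: eqP => // k00; rewrite k00 in k0.
Qed.

Variable p : R -> S -> S -> R.
Hypotheses (ptr : transition_function p) (pQ : has_generator p Q).

Let mph_row_last y k : k.+1 = n ->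
  (mph_row alpha A D y n *m const_mx 1 : 'M[R]_1) =
  mph_row alpha A D y k *m expmx (y k *: A k) *m (D k *m const_mx 1).
Proof. by move=> <-; rewrite /= mulmxA. Qed.

(** Sweeping the row vector through the blocks leaves its pairing with the
    density of the remaining occupation times unchanged. *)
Lemma mph_row_density (y : seq R) k (kn : (k < n)%N) : size y = n ->
  (forall i, 0 <= nth 0 y i) ->
  \sum_i mph_row alpha A D (nth 0 y) k ord0 i *
    path_density p Q mph_level k (drop k y) (state kn i) =
  (mph_row alpha A D (nth 0 y) n *m const_mx 1 : 'M[R]_1) ord0 ord0.
Proof.
move=> sy y0; have [m km] : exists m, (k + m.+1)%N = n.
  by exists (n - k.+1)%N; rewrite addnS -addSn subnKC.
have yk : drop k y = nth 0 y k :: drop k.+1 y by rewrite -drop_nth ?sy.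
have expE j (jn : (j < n)%N) : expmx (nth 0 y j *: A j) =
    \matrix_(i, i') ptrans p (nth 0 y j) (state jn i) (state jn i').
  exact: (expmx_block ptr pQ mph_generator_level (@state_inj j jn)
    (state_level jn) (fun i i' => esym (Q_state jn i i'))).
have sumE j (jn : (j < n)%N) (g : S -> R) :
    \sum_(s | mph_level s == j) g s = \sum_i g (state jn i).
  exact: sum_block (@state_inj j jn) (state_level jn).
have passE j (jn : (j < n)%N) (g : S -> R) :
    \sum_i mph_row alpha A D (nth 0 y) j ord0 i *
      passage p Q mph_level j g (nth 0 y j) (state jn i) =
    \sum_i (mph_row alpha A D (nth 0 y) j *m expmx (nth 0 y j *: A j)) ord0 i *
      \sum_(v | mph_level v == j.+1) Q (state jn i) v * g v.
  under [RHS]eq_bigr do rewrite mxE mulr_suml.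
  rewrite [RHS]exchange_big /=; apply: eq_bigr => i _.
  rewrite /passage (sumE j jn) mulr_sumr; apply: eq_bigr => i' _.
  rewrite (expE j jn) mxE -mulrA; congr (_ * _); rewrite mulr_sumr.
  by apply: eq_bigr => v _; rewrite mulrA.
elim: m k kn km yk => [|m ih] k kn km yk.
  have k1 : k.+1 = n by rewrite -km addn1.
  rewrite (mph_row_last _ k1) mxE yk drop_oversize ?sy ?k1//= passE.
  apply: eq_bigr => i _; congr (_ * _); rewrite -(Q_exit kn i k1).
  rewrite (big_pred1 None) ?mulr1// => -[[l j]|]; last by rewrite /= k1 eqxx.
  by rewrite /= k1 ltn_eqF.
have k1n : (k.+1 < n)%N by rewrite -km !addnS ltnS ltnS leq_addr.
rewrite yk /= passE -(ih k.+1 k1n) ?addSnnS//; last by rewrite -drop_nth ?sy.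
under eq_bigr do rewrite (sumE k.+1 k1n) mulr_sumr.
rewrite exchange_big /=; apply: eq_bigr => j _.
rewrite mxE mulr_suml; apply: eq_bigr => i _.
by rewrite -(Q_next kn k1n) mulrA.
Qed.

Lemma mph_densityE : (0 < n)%N ->
  mph_density alpha A D (n := n) = occupation_density (n := n) pi p Q mph_level.
Proof.
move=> n0; apply/funext => y; rewrite /mph_density /occupation_density.
case: ifP => // /forallP y0; have y0' i : 0 <= nth 0 y i.
  have [yi|iy] := leqP (size y) i; first by rewrite nth_default.
  by rewrite size_tuple in iy; have := y0 (Ordinal iy); rewrite (tnth_nth 0).
rewrite -(mph_row_density n0) ?size_tuple// drop0 /start_density.
rewrite -(big_rmcond_in (fun s => mph_level s == 0%N)) /=; last first.
  by move=> s _ s0; rewrite mph_initial_level ?mul0r.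
rewrite (sum_block _ (@state_inj 0 n0) (state_level n0)); apply: eq_bigr => i _.
congr (_ * _); rewrite /pi /=; case: eqP => // e.
by rewrite cast_ord_idE.
Qed.

End phase_type.

Theorem proposition2p1 (R : realType) (n : nat) (dim : nat -> nat)
    (alpha : 'rV[R]_(dim 0%N)) (A : forall k : nat, 'M[R]_(dim k))
    (D : forall k : nat, 'M[R]_(dim k, dim k.+1))
    (d : measure_display) (T : measurableType d) (P : probability T R)
    (Y : {RV P >-> n.-tuple R}) :
  mph_parameters n alpha A D ->
  multivariate_phase_type alpha A D Y ->
  has_density Y (mph_density alpha A D (n := n)).
Proof.
move=> [n0 _ _ _ _ _ _] [d' [T' [P' [phi [p [mjp pQ tr YP]]]]]].
have ptr := mjp_transition mjp.
have occE w : occupation_times phi w = level_times phi n (@mph_level n dim) w.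
  apply: eq_from_tnth => k; rewrite !tnth_mktuple -(Rintegral_sojourn mjp).
  apply: eq_Rintegral => s _; congr (nat_of_bool _)%:R.
  by case: (phi s w) => [u|] //=; rewrite gtn_eqF.
rewrite (mph_densityE alpha ptr pQ n0); split.
- exact: (measurable_occupation_density mjp pQ).
- exact: (occupation_density_ge0 mjp pQ).
move=> B mB; apply: (law_occupation_density mjp pQ (@mph_generator_level R n dim A D)) => //.
- exact: mph_level_le.
- by move=> [u _|]; [exact: tr|rewrite /= ltnn].
- by move=> s; exact: mph_initial_level.
move=> B' mB'; apply: etrans (YP _ mB') _.
by congr (P' _); apply/seteqP; split => w /=; rewrite occE.
Qed.
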